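(* Let $A$ be a two-sided skew brace such that $(A,+)$ satisfies the maximum condition on subgroups or, equivalently, $(A,\circ)$ satisfies the maximum condition on subgroups. If $(A,+)$ is nilpotent, then $(A,\circ)$ is nilpotent and $A$ is a strongly nilpotent skew brace.
   Context: A skew (left) brace is a triple $(A,+,\circ)$ such that $(A,+)$ and $(A,\circ)$ are (not necessarily abelian) groups and $a\circ(b+c)=a\circ b-a+a\circ c$ for all $a,b,c\in A$. The two groups share the same identity element, denoted $0$. It is two-sided if moreover $(a+b)\circ c=a\circ c-c+b\circ c$ for all $a,b,c\in A$. A group satisfies the maximum condition on subgroups if there exists no infinite strictly ascending chain of subgroups; for two-sided skew braces this condition on $(A,+)$ is equivalent to the same condition on $(A,\circ)$. For $a,b\in A$ put $a*b=-a+a\circ b-b$; for $X,Y\subseteq A$ let $X*Y$ be the subgroup of $(A,+)$ generated by $\{x*y\mid x\in X,y\in Y\}$. Set $A^{[1]}=A$ and, for $n\ge1$, let $A^{[n+1]}$ be the subgroup of $(A,+)$ generated by $\bigcup_{1\le i\le n}A^{[i]}*A^{[n+1-i]}$. The skew brace $A$ is strongly nilpotent if $A^{[n]}=\{0\}$ for some $n$. *)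

(* Defs.v *)
From HB Require Import structures.
From mathcomp Require Import all_boot.
From mathcomp Require Import classical_sets.

Set Implicit Arguments.
Unset Strict Implicit.
Unset Printing Implicit Defensive.

Local Open Scope classical_set_scope.

Section Groups.
Variable G : groupType.
Local Open Scope group_scope.

Definition subgroup (H : set G) : Prop :=
  [/\ H 1, forall x y, H x -> H y -> H (x * y) & forall x, H x -> H x^-1].

Definition generated (X : set G) : set G := smallest subgroup X.

(* [lower_central n] is usually written gamma_(n+1)(G). *)
Fixpoint lower_central (n : nat) : set G :=
  if n is m.+1
  then generated [set [~ x, y] | x in lower_central m & y in [set: G]]
  else [set: G].

Definition nilpotent_group : Prop := exists n, lower_central n = [set 1].

Definition max_on_subgroups : Prop :=
  ~ exists H : nat -> set G,
      forall n, subgroup (H n) /\ H n `<` H n.+1.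

End Groups.

(* The circle group (A, ∘) is the groupType structure of A; the additive     *)
(* group has its own operations because it need not be commutative.  That    *)
(* its zero is the unit 1 of the circle group follows from the axioms.       *)
HB.mixin Record hasBraceAdd A of Group A := {
  brace_add : A -> A -> A;
  brace_zero : A;
  brace_opp : A -> A
}.

HB.structure Definition PreBrace := {A of hasBraceAdd A & Group A}.

Declare Scope brace_scope.
Delimit Scope brace_scope with brace.
Local Open Scope brace_scope.

Reserved Notation "x ∘ y" (at level 40, left associativity).
Notation "x ∘ y" := (mul x y) : brace_scope.
Notation "x + y" := (brace_add x y) : brace_scope.
Notation "0" := (@brace_zero _) : brace_scope.
Notation "- x" := (brace_opp x) : brace_scope.
Notation "x - y" := (brace_add x (brace_opp y)) : brace_scope.

HB.mixin Record isSkewBrace A of PreBrace A := {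
  brace_addA : forall a b c : A, a + (b + c) = (a + b) + c;
  brace_add0l : forall a : A, 0 + a = a;
  brace_add0r : forall a : A, a + 0 = a;
  brace_addNl : forall a : A, - a + a = 0;
  brace_addNr : forall a : A, a + - a = 0;
  brace_circD : forall a b c : A, a ∘ (b + c) = a ∘ b - a + a ∘ c
}.

#[short(type="skewBraceType")]
HB.structure Definition SkewBrace := {A of isSkewBrace A & PreBrace A}.

Definition circ_group (A : skewBraceType) : groupType := A.

Definition add_group (A : skewBraceType) : Type := A.

HB.instance Definition _ (A : skewBraceType) := Choice.on (add_group A).
HB.instance Definition _ (A : skewBraceType) :=
  isGroup.Build (add_group A)
    (@brace_addA A) (@brace_add0l A) (@brace_add0r A)
    (@brace_addNl A) (@brace_addNr A).

Section SkewBraces.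
Variable A : skewBraceType.

Definition two_sided : Prop :=
  forall a b c : A, (a + b) ∘ c = a ∘ c - c + b ∘ c.

Definition star (a b : A) : A := - a + a ∘ b - b.

Definition add_generated (X : set A) : set A := @generated (add_group A) X.

Definition set_star (X Y : set A) : set A :=
  add_generated [set star x y | x in X & y in Y].

(* Course-of-values recursion: [strong_upto n k] is A^[k] for                *)
(* 1 <= k <= n.+1; see strong_power1 and strong_powerS below.                *)
Fixpoint strong_upto (n : nat) : nat -> set A :=
  if n is m.+1 then
    fun k => if (k <= m.+1)%N then strong_upto m k
      else add_generated (\bigcup_(i in [set i | (1 <= i <= m.+1)%N])
             set_star (strong_upto m i) (strong_upto m (m.+2 - i)))
  else fun=> [set: A].

(* A^[n] for n >= 1; the value at n = 0 is irrelevant. *)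
Definition strong_power (n : nat) : set A := strong_upto n.-1 n.

Lemma strong_power1 : strong_power 1 = [set: A].
Proof. by []. Qed.

Lemma strong_uptoE n k : (1 <= k <= n.+1)%N -> strong_upto n k = strong_power k.
Proof.
elim: n => [|n IHn]; first by case: k => [|[|k]].
move=> /andP[k_gt0]; rewrite leq_eqVlt => /orP[/eqP->//|].
by rewrite ltnS /= => k_le; rewrite k_le IHn // k_gt0.
Qed.

Lemma strong_powerS n : (1 <= n)%N ->
  strong_power n.+1 =
  add_generated (\bigcup_(i in [set i | (1 <= i <= n)%N])
    set_star (strong_power i) (strong_power (n.+1 - i))).
Proof.
case: n => // n _; rewrite {1}/strong_power /= ltnn; congr add_generated.
apply: eq_bigcupr => i /= /andP[i_gt0 i_le].
rewrite !strong_uptoE ?i_gt0 // subn_gt0 ltnS i_le /=.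
by rewrite leq_subLR -addn1 addnC leq_add2r.
Qed.

Definition strongly_nilpotent : Prop :=
  exists n, (1 <= n)%N /\ strong_power n = [set 0].

End SkewBraces.

(* Main.v *)
Require Import Defs.
From HB Require Import structures.
From mathcomp Require Import all_boot all_order all_algebra.
From mathcomp Require Import boolp classical_sets.
From mathcomp Require Import ring zify.

(** Two-sidedness makes both lambda_a(x) = -a + a∘x and rho_a(x) = x∘a - a
    automorphisms of (A,+), so its characteristic subgroups are ideals; on the
    centre Z of (A,+) the operation * is bilinear and associative, and A acts on
    Z from both sides through radical rings of commuting operators.  By the
    maximum condition the upper central series of the skew brace A stabilizes at
    an ideal K, and it is enough to show that a nonzero A / K has a nonzero
    annihilator, that is, central elements z of (A,+) with a * z = z * a = 0.

    If subgroups of Z are finitely generated, Nakayama's lemma modulo each prime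
    p shows that products of d operators map Z into pZ, where d is the number of
    generators; so they vanish on Z if Z is torsion-free, and on Z[p] for every
    p.  Hence some nonzero z is killed by the left action, and likewise on the
    right.

    If only (A,∘) has the maximum condition, it suffices to find an ideal I <= Z
    with I * I = 0, as the two operations agree on I.  Every element a of the
    radical ring Z (or Z[p]) is nilpotent: evaluating at a the pairwise
    comaximal polynomials P_n = 1 + X P_0 ... P_(n-1) gives a chain of subgroups
    of the adjoint group, whose stabilization yields a polynomial relation
    satisfied by a.  Levitzki's argument then produces I. *)

Set Implicit Arguments.
Unset Strict Implicit.
Unset Printing Implicit Defensive.

Import Order.TTheory GRing.Theory Num.Theory.
Local Open Scope classical_set_scope.
Local Open Scope ring_scope.

(** * Chain conditions and subgroups of abelian groups *)

Definition no_ascending T (P : set T -> Prop) : Prop :=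
  ~ exists H : nat -> set T, forall n, P (H n) /\ H n `<` H n.+1.

(** By dependent choice: if every set satisfying [Q] were strictly contained in another one,
    iterating would build a forbidden chain. *)
Lemma maximal_no_ascending T (P Q : set T -> Prop) : no_ascending P ->
    (forall H, Q H -> P H) -> (exists H, Q H) ->
  exists2 H, Q H & forall H', Q H' -> H `<=` H' -> H' `<=` H.
Proof.
move=> accP QP [H0 QH0]; apply: contrapT => noH; apply: accP.
have next (H : {H | Q H}) : exists H' : {H | Q H}, sval H `<` sval H'.
  apply: contrapT => noH'; apply: noH; exists (sval H); first exact: (svalP H).
  move=> H' QH' sHH'; apply: contrapT => nsH'H; apply: noH'.
  by exists (exist _ H' QH').
have [f fP] := choice next; exists (fun n => sval (iter n f (exist _ H0 QH0))).
by move=> n; split; [apply/QP/svalP | apply: fP].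
Qed.

Section AdditiveSubgroups.
Variable M : zmodType.
Implicit Types (H K L : set M) (s : seq M) (x y v : M).

Definition add_subgroup H : Prop := H 0 /\ forall x y, H x -> H y -> H (x - y).

Lemma add_subgroupN H x : add_subgroup H -> H x -> H (- x).
Proof. by move=> [H0 HB] Hx; rewrite -sub0r; apply: HB. Qed.

Lemma add_subgroupD H x y : add_subgroup H -> H x -> H y -> H (x + y).
Proof.
move=> gH Hx Hy; rewrite -[y]opprK; apply: (gH.2) => //.
exact: add_subgroupN.
Qed.

Lemma add_subgroupMn H x n : add_subgroup H -> H x -> H (x *+ n).
Proof.
move=> gH Hx; elim: n => [|n IHn]; first by rewrite mulr0n; case: gH.
by rewrite mulrS; apply: add_subgroupD.
Qed.

Lemma add_subgroupMz H x (n : int) : add_subgroup H -> H x -> H (x *~ n).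
Proof.
move=> gH Hx; case: n => n; first exact: add_subgroupMn.
by rewrite NegzE mulrNz; apply: (add_subgroupN gH); apply: add_subgroupMn.
Qed.

Lemma add_subgroup0 : add_subgroup [set 0].
Proof. by split=> // x y -> ->; rewrite subr0. Qed.

Lemma add_subgroup_smallest (X : set M) :
  add_subgroup (smallest add_subgroup X).
Proof.
split=> [H [[]]//|x y Hx Hy H [gH sH]].
by apply: (gH.2); [apply: Hx | apply: Hy].
Qed.

(** The sum of [K] and the integer span of [s], with one coefficient split off at a time to suit
    induction on [s]. *)
Fixpoint span_mod K s : set M :=
  if s is v :: s' then [set x | exists n : int, span_mod K s' (x - v *~ n)]
  else K.

Lemma add_subgroup_span K s : add_subgroup K -> add_subgroup (span_mod K s).
Proof.
move=> gK; elim: s => //= v s [IH0 IHB]; split.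
  by exists 0; rewrite mulr0z subr0.
move=> x y [n Hx] [m Hy]; exists (n - m).
rewrite (_ : _ - _ = (x - v *~ n) - (y - v *~ m)); first exact: IHB.
by rewrite mulrzBr !opprB addrACA [RHS]addrACA [- y - _]addrC.
Qed.

Lemma sub_span_cons K v s : span_mod K s `<=` span_mod K (v :: s).
Proof. by move=> x Hx; exists 0; rewrite mulr0z subr0. Qed.

Lemma sub_span_base K s : K `<=` span_mod K s.
Proof. by elim: s => //= v s IHs x /IHs; apply: sub_span_cons. Qed.

Lemma mem_span K s v : add_subgroup K -> v \in s -> span_mod K s v.
Proof.
move=> gK; elim: s => //= w s IHs; rewrite inE => /predU1P[-> | /IHs].
  by exists 1; rewrite subrr; have [] := add_subgroup_span s gK.
exact: sub_span_cons.
Qed.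

Lemma span_sub K H s : add_subgroup H -> K `<=` H ->
  (forall v, v \in s -> H v) -> span_mod K s `<=` H.
Proof.
move=> gH sKH; elim: s => //= v s IHs Hs x [n Hx].
rewrite -(subrK (v *~ n) x); apply: add_subgroupD => //.
  by apply: IHs Hx => w ws; apply: Hs; rewrite inE ws orbT.
by apply: add_subgroupMz => //; apply: Hs; rewrite inE eqxx.
Qed.

Lemma bezout_prime (p n : nat) : prime p -> ~~ (p %| n)%N ->
  exists u v : int, u * p%:Z + v * n%:Z = 1.
Proof.
move=> p_pr pn; have /coprimeP : coprime p n by rewrite prime_coprime.
case=> [|[u v] /= /esym uvE]; first exact: prime_gt0.
exists u%:Z, (- v%:Z); have := uvE; lia.
Qed.

Lemma bezout_primez (p : nat) (n : int) : prime p -> ~~ (p %| `|n|)%N ->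
  exists u v : int, u * p%:Z + v * n = 1.
Proof.
move=> p_pr /(bezout_prime p_pr)[u [v uvE]].
by exists u, (v * sgz n); rewrite -mulrA -abszEsg // uvE.
Qed.

(* Modulo [K] this is linear algebra over the field with [p] elements: a      *)
(* subspace of a space with [n] generators has at most [n] generators, and    *)
(* strictly fewer when it is proper.                                          *)
Lemma span_subgroup p K L s : prime p -> add_subgroup K -> add_subgroup L ->
    K `<=` L -> L `<=` span_mod K s -> (forall v, v \in s -> K (v *+ p)) ->
  exists s', [/\ (size s' <= size s)%N, forall v, v \in s' -> L v,
    L `<=` span_mod K s' & size s' = size s -> span_mod K s `<=` L].
Proof.
move=> p_pr gK; elim: s L => [|v s IHs] L gL sKL sLs Ks.
  by exists [::]; split=> // _ x /sKL.
have gs := add_subgroup_span s gK.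
(* The induction handles the part of [L] that needs no multiple of [v]. *)
have [|||?|s' [size_s' s'L Ls' eq_s']] := IHs (L `&` span_mod K s).
- split=> [|x y [Lx sx] [Ly sy]]; first by case: gL; case: gs.
  by split; [apply: gL.2 | apply: gs.2].
- by move=> x Kx; split; [apply: sKL | apply: sub_span_base].
- by move=> x [].
- by move=> ws; apply: Ks; rewrite inE ws orbT.
have [sLs0|/existsNP[w /not_implyP[Lw nsw]]] := pselect (L `<=` span_mod K s).
  exists s'; split=> //=; first exact: leqW.
  - by move=> w /s'L[].
  - by move=> x Lx; apply: Ls'; split=> //; apply: sLs0.
  - by move=> e; move: size_s'; rewrite e ltnn.
have [n wn] := sLs w Lw.
have Kv : K (v *+ p) by apply: Ks; rewrite inE eqxx.
have pn : ~~ (p %| `|n|)%N.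
  apply/negP => /(@dvdzP p n)[k nE]; apply: nsw; rewrite -(subrK (v *~ n) w).
  apply: add_subgroupD => //; apply: sub_span_base.
  by rewrite nE mulrC mulrzA; apply: add_subgroupMz.
(* The [v]-coefficient [n] of [w] has inverse [b] modulo [p], so [w'] is congruent to [v] modulo the
   span of [s] and can replace [v]. *)
have [a [b abE]] := bezout_primez p_pr pn.
set w' := w *~ b.
have Lw' : L w' by apply: add_subgroupMz.
have sw' : span_mod K s (w' - v).
  rewrite -[v in w' - v]mulr1z -abE mulrzDr opprD addrCA addrC.
  apply: add_subgroupD => //.
    rewrite /w' [b * n]mulrC mulrzA -mulNrz -mulrzDl.
    exact: add_subgroupMz.
  apply: (add_subgroupN gs); apply: sub_span_base.
  by rewrite mulrC mulrzA; apply: add_subgroupMz.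
exists (w' :: s'); split=> //=.
- by move=> x; rewrite inE => /predU1P[->//|/s'L[]].
- move=> x Lx; have [k sk] := sLs x Lx; exists k.
  apply: Ls'; split; first by apply: gL.2 => //; apply: add_subgroupMz.
  rewrite (_ : x - w' *~ k = (x - v *~ k) - (w' - v) *~ k).
    by apply: gs.2 => //; apply: add_subgroupMz.
  by rewrite mulrzBl opprB [RHS]addrCA addrA addrC subrKC addrC.
- move=> [/eq_s' sL] x [k sk]; rewrite -(subrK (v *~ k) x).
  have sL' y : span_mod K s y -> L y by move/sL => [].
  apply: add_subgroupD => //; first exact: sL'.
  apply: add_subgroupMz => //; rewrite -[v](subKr w').
  by apply: gL.2 => //; apply: sL'.
Qed.

(** A subgroup maximal among the finitely generated subgroups of [W] absorbs each further element of
    [W]. *)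
Lemma no_ascending_fg (P : set M -> Prop) W : no_ascending P ->
    (forall H, add_subgroup H -> H `<=` W -> P H) -> add_subgroup W ->
  exists2 s, forall v, v \in s -> W v & W `<=` span_mod [set 0] s.
Proof.
move=> accP subP gW; have g0 := add_subgroup0.
pose Q H := exists2 s, forall v, v \in s -> W v & H = span_mod [set 0] s.
have spanW s : (forall v, v \in s -> W v) -> span_mod [set 0] s `<=` W.
  by apply: span_sub => // x ->; case: gW.
have [|| H [s sW ->] Hmax] := maximal_no_ascending (Q := Q) accP.
- move=> H [s sW ->]; apply: subP; last exact: spanW.
  exact: add_subgroup_span.
- by exists [set 0], [::].
exists s => // x Wx; apply: (Hmax (span_mod [set 0] (x :: s))).
- by exists (x :: s) => // v; rewrite inE => /predU1P[->//|/sW].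
- exact: sub_span_cons.
- by apply: mem_span; rewrite ?inE ?eqxx.
Qed.

Lemma torsion_free_primes W : add_subgroup W ->
    (forall p x, prime p -> W x -> x *+ p = 0 -> x = 0) ->
  forall n x, (0 < n)%N -> W x -> x *+ n = 0 -> x = 0.
Proof.
move=> gW tfW n; elim/ltn_ind: n => n IHn x n_gt0 Wx xn0.
have [n_le1|n_gt1] := leqP n 1.
  move: xn0; rewrite (_ : n = 1%N) ?mulr1n //.
  by apply/eqP; rewrite eqn_leq n_le1.
have p_pr := pdiv_prime n_gt1; have p_dv := pdiv_dvd n.
apply: (IHn (n %/ pdiv n)%N) => //.
- exact: ltn_Pdiv (prime_gt1 p_pr) n_gt0.
- by rewrite divn_gt0 ?prime_gt0 // dvdn_leq.
- apply: tfW p_pr _ _; first exact: add_subgroupMn.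
  by rewrite -mulrnA divnK.
Qed.

End AdditiveSubgroups.

(** * Radical rings acting on finitely generated abelian groups *)

Section RadicalAction.
Variables (T : Type) (M : zmodType) (op : T -> M -> M).
Implicit Types (K W : set M) (s : seq M) (l : seq T).

(* The operators [op a] form a (non-unital) ring of endomorphisms of [M] in   *)
(* which every element is left quasi-regular.                                 *)
Definition radical_action : Prop :=
  [/\ forall a x y, op a (x + y) = op a x + op a y,
      exists c, forall x, op c x = 0,
      forall a b, exists c, forall x, op c x = op a x - op b x,
      forall a b, exists c, forall x, op c x = op a (op b x) &
      forall a, exists b, forall x, op b (x + op a x) = - op a x].

Hypothesis opR : radical_action.

Let opD a x y : op a (x + y) = op a x + op a y. Proof. by case: opR. Qed.

Let op0 a : op a 0 = 0.
Proof. by apply: (addrI (op a 0)); rewrite -opD !addr0. Qed.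

Let opN a x : op a (- x) = - op a x.
Proof. by apply: (addrI (op a x)); rewrite -opD !subrr op0. Qed.

Let opMn a x n : op a (x *+ n) = op a x *+ n.
Proof. by elim: n => [|n IHn]; rewrite ?mulr0n ?op0 // !mulrS opD IHn. Qed.

Let opMz a x (n : int) : op a (x *~ n) = op a x *~ n.
Proof. by case: n => n; rewrite ?opMn // NegzE !mulrNz opN opMn. Qed.

Let op_opp a : exists c, forall x, op c x = - op a x.
Proof.
case: opR => _ [z zE] cB _ _; have [c cE] := cB z a.
by exists c => x; rewrite cE zE sub0r.
Qed.

Let op_mulz a (n : int) : exists c, forall x, op c x = op a x *~ n.
Proof.
case: opR => _ c0 cB _ _; have [b bE] := op_opp a.
have cMn k : exists c, forall x, op c x = op a x *+ k.
  elim: k => [|k [c cE]]; first by have [z zE] := c0; exists z => x; rewrite zE.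
  have [d dE] := cB c b; exists d => x.
  by rewrite dE cE bE opprK mulrSr.
case: n => n; first exact: cMn.
have [c cE] := cMn n.+1; have [d dE] := op_opp c.
by exists d => x; rewrite dE cE NegzE mulrNz.
Qed.

Definition submodule W : Prop :=
  add_subgroup W /\ forall a x, W x -> W (op a x).

Let act_span K W : set M :=
  smallest (@add_subgroup M)
    [set x | K x \/ exists a, exists2 y, W y & x = op a y].

Let act_span_sub K W H : add_subgroup H -> K `<=` H ->
  (forall a x, W x -> H (op a x)) -> act_span K W `<=` H.
Proof.
by move=> gH sKH opH; apply: smallest_sub => // x [/sKH|[a [y Wy ->]]]; auto.
Qed.

Let mem_act_span K W a x : W x -> act_span K W (op a x).
Proof. by move=> Wx; apply: sub_gen_smallest; right; exists a, x. Qed.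

Let act_span_base K W : K `<=` act_span K W.
Proof. by move=> x Kx; apply: sub_gen_smallest; left. Qed.

Let act_span_submodule K W : submodule K -> submodule W -> K `<=` W ->
  submodule (act_span K W) /\ act_span K W `<=` W.
Proof.
move=> [gK opK] [gW opW] sKW.
have sW : act_span K W `<=` W by apply: act_span_sub.
split=> //; split; first exact: add_subgroup_smallest.
by move=> a x /sW; apply: mem_act_span.
Qed.

(** The analogue of [span_mod] with operators as coefficients. The ring of operators need not have a
    unit, so the generators need not lie in it. *)
Fixpoint op_span K s : set M :=
  if s is v :: s' then [set x | exists a, op_span K s' (x - op a v)] else K.

Let op_span_cons K v s : op_span K s `<=` op_span K (v :: s).
Proof.
by case: opR => _ [z zE] _ _ _ x Kx; exists z; rewrite zE subr0.
Qed.

Let submodule_op_span K s : submodule K -> submodule (op_span K s).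
Proof.
case: opR => _ _ cB cM _ mK; elim: s => //= v s [gs ops]; split; first split.
- by apply: op_span_cons; case: gs.
- move=> x y [a xa] [b yb]; have [c cE] := cB a b; exists c; rewrite cE.
  rewrite (_ : _ - _ = (x - op a v) - (y - op b v)); first exact: gs.2.
  by rewrite !opprB addrACA [RHS]addrACA [- y - _]addrC.
- move=> b x [a xa]; have [c cE] := cM b a; exists c.
  by rewrite cE -opN -opD; apply: ops.
Qed.

Let act_span_op_span K W s : submodule K -> W `<=` span_mod K s ->
  act_span K W `<=` op_span K s.
Proof.
move=> mK sWs; have [gs _] := submodule_op_span s mK.
apply: act_span_sub => //.
  by elim: s {gs sWs} => //= v s IHs x /IHs; apply: op_span_cons.
move=> a x /sWs; elim: s x {gs sWs} => [|v s IHs] x /=; first exact: mK.2.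
case=> n /IHs; rewrite opD opN opMz.
by have [c cE] := op_mulz a n; rewrite -cE; exists c.
Qed.

Let nakayama_gens K s : submodule K ->
  (forall v, v \in s -> op_span K s v) -> forall v, v \in s -> K v.
Proof.
move=> mK; have [_ _ _ _ cQ] := opR.
elim: s => // v s IHs svs; have [gs ops] := submodule_op_span s mK.
have vs : op_span K s v.
  have [|a va] := svs v; first by rewrite inE eqxx.
  have [a' a'E] := op_opp a; have [b bE] := cQ a'.
  move: (va); rewrite -a'E => /[dup] /(ops b) + va'.
  rewrite bE a'E opprK => opav; rewrite -(subrK (op a v) v).
  exact: add_subgroupD.
have Ks : forall w, w \in s -> K w.
  apply: IHs => w ws; have [|a wa] := svs w; first by rewrite inE ws orbT.
  rewrite -(subrK (op a v) w); apply: add_subgroupD => //; exact: ops.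
move=> w; rewrite inE => /predU1P[->|/Ks//].
elim: s {IHs svs gs ops} vs Ks => //= w0 s IHs [a va] Ks.
apply: IHs => [|u us]; last by apply: Ks; rewrite inE us orbT.
have [gs ops] := submodule_op_span s mK.
rewrite -(subrK (op a w0) v); apply: add_subgroupD => //; apply: ops.
have: K w0 by apply: Ks; rewrite inE eqxx.
by elim: (s) => //= u s' IHs' /IHs'; apply: op_span_cons.
Qed.

Let nakayama K W s : submodule K -> add_subgroup W ->
    (forall v, v \in s -> W v) ->
  W `<=` span_mod K s -> W `<=` act_span K W -> W `<=` K.
Proof.
move=> mK gW sW Ws WSW x /Ws.
apply: span_sub => //; first by case: mK.
apply: nakayama_gens => // v /sW/WSW; exact: act_span_op_span.
Qed.

(* Modulo [p], each application of the operators lowers the number of         *)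
(* generators, by Nakayama's lemma.                                           *)
Lemma words_nilpotent_mod p K W s : prime p -> submodule K -> submodule W ->
    K `<=` W -> (forall v, v \in s -> W v) -> W `<=` span_mod K s ->
    (forall x, W x -> K (x *+ p)) ->
  forall l x, (size s <= size l)%N -> W x -> K (foldr op x l).
Proof.
move=> p_pr mK; have [gK opK] := mK; move: {2}(size s) (leqnn (size s)) => n.
have foldK l x : K x -> K (foldr op x l).
  by move=> Kx; elim: l => //= a l; apply: opK.
elim: n s W => [|n IHn] s W le_s mW sKW sW Ws pW l x le_l Wx.
  by case: s le_s Ws {sW le_l} => // _ /(_ _ Wx) Kx; apply: foldK.
have [mW' sW'W] := act_span_submodule mK mW sKW.
have [|||v /sW/pW|s' [le_s' s'W' W's' eq_s']] :=
  span_subgroup (L := act_span K W) (s := s) p_pr gK => //.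
- by case: mW'.
- by move=> y /sW'W/Ws.
(* If no generator is saved, the operators map [W] onto itself modulo [K], and Nakayama's lemma
   gives W inside [K]. *)
have [eq_size|ne_size] := eqVneq (size s') (size s).
  apply: foldK; apply: (@nakayama K W s) => //; first exact: mW.1.
  by move=> y /Ws/(eq_s' eq_size).
have lt_s' : (size s' < size s)%N by rewrite ltn_neqAle ne_size.
(* The last letter of the word acts first: it sends [x] into [act_span K W], which has fewer
   generators. *)
case: (lastP l) le_l => [|l' a].
  by rewrite leqn0 => /eqP s0; rewrite s0 in lt_s'.
rewrite size_rcons foldr_rcons => le_l.
apply: (IHn s' (act_span K W)) => //.
- by rewrite -ltnS (leq_trans lt_s').
- by move=> y /sW'W/pW.
- by rewrite -ltnS (leq_trans lt_s').
- exact: mem_act_span.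
Qed.

(** A nonzero value of a longest word that does not vanish on [W] is killed by every operator. *)
Lemma words_nilpotent_killed n W : submodule W -> (exists2 x, W x & x != 0) ->
    (forall l x, size l = n -> W x -> foldr op x l = 0) ->
  exists z, [/\ W z, z != 0 & forall a, op a z = 0].
Proof.
move=> mW [w Ww w0]; elim: n => [|n IHn] Hn.
  by have := Hn [::] w erefl Ww; move/eqP: w0.
have [/IHn//|/existsNP[l /existsNP[x]]] :=
  pselect (forall l x, size l = n -> W x -> foldr op x l = 0).
move=> /not_implyP[sl /not_implyP[Wx /eqP nz]]; exists (foldr op x l); split=> //.
  by elim: (l) => //= a l' IH; apply: mW.2.
by move=> a; apply: (Hn (a :: l)) => //=; rewrite sl.
Qed.

Lemma radical_action_killed (P : set M -> Prop) W : no_ascending P ->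
    (forall H, add_subgroup H -> H `<=` W -> P H) ->
    submodule W -> (exists2 x, W x & x != 0) ->
  exists z, [/\ W z, z != 0 & forall a, op a z = 0].
Proof.
move=> accP subP mW [w0 Ww0 nz_w0]; have [gW opW] := mW.
have m0 : submodule [set 0].
  by split=> [|a x ->]; [exact: add_subgroup0 | rewrite /= op0].
have [[p [x [p_pr Wx nz_x px0]]]|notor] :=
  pselect (exists p x, [/\ prime p, W x, x != 0 & x *+ p = 0]).
  pose V : set M := [set y | W y /\ y *+ p = 0].
  have mV : submodule V.
    split; first split; first by split; [case: gW | rewrite mul0rn].
      move=> y z [Wy py] [Wz pz]; split; first exact: gW.2.
      by rewrite mulrnBl py pz subr0.
    by move=> a y [Wy py]; split; [apply: opW | rewrite -opMn py op0].
  have [|s sV Vs] := no_ascending_fg accP _ mV.1.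
    by move=> H gH sHV; apply: subP => // y /sHV[].
  have [||z [[Wz _] nz_z opz]] := words_nilpotent_killed (n := size s) mV.
  - by exists x.
  - move=> l y sl Vy.
    apply: (words_nilpotent_mod (p := p) (K := [set 0]) (W := V) (s := s)) => //.
    + by move=> _ ->; case: mV => - [].
    + by move=> z [].
    + by rewrite sl.
  - by exists z.
have tf : forall n x, (0 < n)%N -> W x -> x *+ n = 0 -> x = 0.
  apply: torsion_free_primes => // p x p_pr Wx px0; apply: contrapT => /eqP nz_x.
  by apply: notor; exists p, x.
have [s sW Ws] := no_ascending_fg accP subP gW.
apply: (words_nilpotent_killed (n := size s)) => //; first by exists w0.
move=> l x sl Wx; set y := foldr op x l.
have Wy : W y by rewrite /y; elim: (l) => //= a l' IH; apply: opW.
(* The quotient of [W] by pW is killed by [p], so a word as long as [s] maps [W] into pW, for every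
   prime at once. *)
have yp p : prime p -> exists2 z, W z & y = z *+ p.
  move=> p_pr; pose K : set M := [set z *+ p | z in W].
  have mK : submodule K.
    split; first split; first by exists 0; [case: gW | rewrite mul0rn].
      move=> _ _ [u Wu <-] [v Wv <-]; exists (u - v); first exact: gW.2.
      by rewrite mulrnBl.
    by move=> a _ [u Wu <-]; exists (op a u); [apply: opW | rewrite opMn].
  have sub0K : [set 0] `<=` span_mod K s.
    by move=> _ ->; case: (add_subgroup_span s mK.1).
  suff: K y by case=> z Wz <-; exists z.
  apply: (words_nilpotent_mod p_pr mK mW _ sW); rewrite ?sl //.
  - by move=> _ [u Wu <-]; apply: add_subgroupMn.
  - move=> u /Ws; apply: span_sub => //; first exact: add_subgroup_span mK.1.
    by move=> v; apply: mem_span mK.1.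
  - by move=> u Wu; exists u.
apply: contrapT => /eqP nz_y.
(* A maximal cyclic subgroup <z> among those with N z = y cannot exist: y is  *)
(* also divisible by a prime not dividing N.                                  *)
pose cyc z : set M := [set z *~ k | k in [set: int]].
pose Q H := exists z N, [/\ W z, (0 < N)%N, y = z *+ N & H = cyc z].
have [||H [z [N [Wz N_gt0 yz ->]]] Hmax] := maximal_no_ascending (Q := Q) accP.
- move=> H [z [N [Wz _ _ ->]]]; apply: subP => [|_ [k _ <-]].
    split=> [|_ _ [k _ <-] [k' _ <-]]; first by exists 0; rewrite // mulr0z.
    by exists (k - k'); rewrite // mulrzBr.
  exact: add_subgroupMz.
- by exists (cyc y), y, 1%N; rewrite mulr1n; split.
have [p p_gtN p_pr] := prime_above N.
have [t Wt yt] := yp p p_pr.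
have [u [v uvE]] : exists u v : int, u * p%:Z + v * N%:Z = 1.
  by apply: bezout_prime => //; rewrite gtnNdvd.
(* From y = N z = p t one gets p z' = (u p + v N) z = z, so the cyclic group of [z'] contains that
   of [z]. *)
pose z' := z *~ u + t *~ v.
have Wz' : W z' by apply: add_subgroupD => //; apply: add_subgroupMz.
have zE : z = z' *+ p.
  rewrite mulrnDl -{1}[z]mulr1z -uvE mulrzDr [u * _]mulrC [v * _]mulrC !mulrzA.
  by rewrite -!pmulrn -yz yt !pmulrn -!mulrzA ![_ * p%:Z]mulrC.
have [|||k _ zk] := Hmax (cyc z') _ _ z'.
- exists z', (N * p)%N; split=> //; first by rewrite muln_gt0 N_gt0 prime_gt0.
  by rewrite mulnC mulrnA -zE.
- move=> _ [k _ <-]; exists (p%:Z * k) => //.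
  by rewrite mulrzA -pmulrn -zE.
- by exists 1; rewrite ?mulr1z.
(* By maximality z' = k z = k p z', so [d] kills [z']; and [d] is nonzero because [p] is not a
   unit. *)
pose d : int := p%:Z * k - 1.
have z'0 : z' *~ d = 0.
  by rewrite mulrzBr mulrzA -pmulrn -zE zk mulr1z subrr.
have d_nz : (0 < absz d)%N.
  rewrite absz_gt0 subr_eq0; apply/negP => /eqP/(congr1 absz).
  rewrite abszM => /eqP; rewrite muln_eq1 => /andP[/eqP p1 _].
  by move: p_pr; rewrite -[p]absz_nat p1.
have z'_0 : z' = 0.
  by apply: tf d_nz Wz' _; rewrite pmulrn abszEsg mulrC mulrzA z'0 mul0rz.
by move/eqP: nz_y; rewrite yz zE z'_0 !mul0rn.
Qed.

End RadicalAction.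

(** * Nil ideals of rings whose adjoint group satisfies the maximum condition *)

Section EuclidPolynomials.

(* As in Euclid's proof of the infinitude of primes, each [euclid_poly n] is  *)
(* comaximal with all the previous ones.                                      *)
Fixpoint euclid_prod n : {poly int} :=
  if n is m.+1 then euclid_prod m * (1 + 'X * euclid_prod m) else 1.

Definition euclid_poly n : {poly int} := 1 + 'X * euclid_prod n.

(** These polynomials supply the numerators and denominators for the [n]-th subgroup in the chain of
    [euclid_relation]. *)
Definition euclid_monoid n (A : {poly int}) : Prop :=
  exists e : nat -> nat, A = \prod_(i < n) euclid_poly i ^+ e i.

Lemma euclid_monoid1 n : euclid_monoid n 1.
Proof. by exists (fun=> 0%N); rewrite big1. Qed.

Lemma euclid_monoidM n A B :
  euclid_monoid n A -> euclid_monoid n B -> euclid_monoid n (A * B).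
Proof.
move=> [e ->] [e' ->]; exists (fun i => e i + e' i)%N.
by rewrite -big_split; apply: eq_bigr => i _; rewrite exprD.
Qed.

Lemma euclid_monoidS n A : euclid_monoid n A -> euclid_monoid n.+1 A.
Proof.
move=> [e ->]; exists (fun i => if (i < n)%N then e i else 0%N).
rewrite big_ord_recr /= ltnn expr0 mulr1.
by apply: eq_bigr => i _; rewrite ltn_ord.
Qed.

Lemma euclid_monoid_last n : euclid_monoid n.+1 (euclid_poly n).
Proof.
exists (fun i => (i == n)); rewrite big_ord_recr /= eqxx expr1 big1 ?mul1r //.
by move=> i _; rewrite ltn_eqF.
Qed.

(** Comaximality with [euclid_poly n] is stable under products, and for i < n the polynomial
    [euclid_poly i] divides [euclid_poly n - 1]. *)
Lemma euclid_comaximal n A : euclid_monoid n A ->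
  exists r s, r * A + s * euclid_poly n = 1.
Proof.
case=> e ->.
pose comax (x : {poly int}) := exists r s, r * x + s * euclid_poly n = 1.
apply: (big_ind comax); first by exists 1, 0; ring.
  move=> x y [r [s rs]] [r' [s' rs']]; exists (r * r').
  exists (r * x * s' + s * r' * y + s * s' * euclid_poly n).
  have -> : 1 = (r * x + s * euclid_poly n) * (r' * y + s' * euclid_poly n).
    by rewrite rs rs' mulr1.
  by ring.
have dvd_prod i m : (i < m)%N -> exists q, euclid_prod m = euclid_poly i * q.
  elim: m => // m IHm; rewrite ltnS leq_eqVlt => /predU1P[->|/IHm[q /= ->]].
    by exists (euclid_prod m); rewrite /= mulrC.
  by eexists; rewrite -mulrA.
move=> i _; elim: (e i) => [|k [r [s rs]]]; first by exists 1, 0; ring.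
have [q qE] := dvd_prod _ _ (ltn_ord i).
exists (r * - ('X * q)), (r * euclid_poly i ^+ k + s); rewrite -rs.
have -> : euclid_poly n = 1 + 'X * (euclid_poly i * q).
  by rewrite [LHS]/euclid_poly qE.
by rewrite exprS; ring.
Qed.

(** The image of [euclid_poly n] divides that of [B], to which it is comaximal, so it divides 1.
    Rings where this image is not a unit thus rule out the relation. *)
Lemma euclid_relation_unit (D : comNzRingType) (f : {rmorphism {poly int} -> D})
    n A B : euclid_monoid n B -> f (euclid_poly n * A) = f B ->
  exists v, v * f (euclid_poly n) = 1.
Proof.
move=> /euclid_comaximal[r [s /(congr1 f)]]; rewrite rmorphD rmorph1 => rs eqf.
exists (f r * f A + f s); rewrite -rs !rmorphM -eqf rmorphM; ring.
Qed.

(** At a positive integer, [euclid_poly n] takes a value greater than 1, which is not a unit of the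
    integers. *)
Lemma euclid_relation_horner n A B (N : int) : euclid_monoid n B -> 0 < N ->
  (euclid_poly n * A - B).[N] != 0.
Proof.
move=> TB N_gt0; rewrite hornerD hornerN subr_eq0; apply/eqP => eqN.
have [v] := euclid_relation_unit (f := horner_eval N) TB eqN.
have prod_gt0 m : 0 < (euclid_prod m).[N].
  elim: m => [|m IHm] /=; first by rewrite hornerE.
  by rewrite !hornerE mulr_gt0 // addr_gt0 // mulr_gt0.
rewrite /= /horner_eval /euclid_poly !hornerE.
have := prod_gt0 n; move: (euclid_prod n).[N] => x x_gt0.
have : 1 < 1 + N * x by rewrite ltrDl mulr_gt0.
have no_unit (u y : int) : 1 < y -> u * y = 1 -> False.
  by move=> y_gt1; have [u_le0|u_gt0] := lerP u 0; nia.
exact: no_unit.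
Qed.

(** Modulo [p], [euclid_poly n] has positive degree, so it is not a unit of the polynomial ring. *)
Lemma euclid_relation_coef_prime p n A B : prime p -> euclid_monoid n B ->
  exists i, ~~ (p %| (euclid_poly n * A - B)`_i)%Z.
Proof.
move=> p_pr TB; apply: contrapT => nex.
pose f : {rmorphism {poly int} -> {poly 'F_p}} := map_poly intr.
have: f (euclid_poly n * A - B) = 0.
  apply/polyP => i; rewrite coef_map coef0 /=.
  have /dvdzP[q ->] : (p %| (euclid_poly n * A - B)`_i)%Z.
    by apply: contrapT => /negP ndvd; apply: nex; exists i.
  by rewrite intrM -[p%:~R]/(p%:R) pchar_Fp_0 // mulr0.
rewrite rmorphB => /eqP; rewrite subr_eq0 => /eqP /(euclid_relation_unit TB)[v].
have size_euclid m : f (euclid_prod m) != 0 ->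
    size (f (euclid_poly m)) = (size (f (euclid_prod m))).+1.
  move=> nz; rewrite rmorphD rmorph1 rmorphM /= map_polyX mulrC addrC.
  by rewrite size_polyDl size_mulX // size_poly1 ltnS size_poly_gt0.
have prod_nz m : f (euclid_prod m) != 0.
  elim: m => [|m IHm]; first by rewrite rmorph1 oner_eq0.
  rewrite rmorphM mulf_neq0 // -size_poly_gt0.
  by have := size_euclid m IHm; rewrite /euclid_poly => ->.
have v_nz : v * f (euclid_poly n) = 1 -> v != 0.
  by move=> vE; apply/eqP => v0; move/eqP: vE; rewrite v0 mul0r eq_sym oner_eq0.
have nz : f (euclid_poly n) != 0 by rewrite -size_poly_gt0 size_euclid.
move=> vE; have := congr1 (fun q : {poly _} => size q) vE.
rewrite size_mul ?v_nz // size_euclid // size_poly1 addnS /=.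
have := v_nz vE; have := prod_nz n; rewrite -!size_poly_gt0.
by rewrite -[map_poly _ _]/(f _); move: (size (f _)) (size v) => i j; lia.
Qed.

(** Here [c] is the lowest coefficient not divisible by [p], and [H] collects the multiples of [p]
    below it. With p = 0 this factors out the largest power of X. *)
Lemma poly_int_lowest_mod (p : nat) (G : {poly int}) :
    (exists i, ~~ (p %| G`_i)%Z) ->
  exists k c g H, ~~ (p %| c)%Z /\ G = 'X^k * (c%:P + 'X * g) + p%:Z%:P * H.
Proof.
elim/poly_ind: G => [|G c0 IHG] [i]; first by rewrite coef0 dvdz0.
have [/dvdzP[q ->]|nd] := boolP (p %| c0)%Z; last first.
  by exists 0%N, c0, G, 0; split=> //; ring.
rewrite coefD coefMX coefC; case: i => [|i] /=.
  by rewrite add0r dvdz_mull.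
rewrite addr0 => Gi; have [|k [c [g [H [nd ->]]]]] := IHG; first by exists i.
exists k.+1, c, g, (H * 'X + q%:P); split=> //.
rewrite exprS polyCM; ring.
Qed.

End EuclidPolynomials.

(** * Nilpotent elements of radical ideals *)

Section RadicalIdeals.
Variables (U : nzRingType) (J : set U).
Implicit Types (a x y : U) (W H : set U) (G : {poly int}).

Definition ring_ideal W : Prop :=
  add_subgroup W /\ forall a x, W x -> W (a * x) /\ W (x * a).

Definition radical_ideal : Prop :=
  ring_ideal J /\
  forall x, J x -> exists2 y, (1 + x) * y = 1 & y * (1 + x) = 1.

(** Subgroups of the group 1 + [J]; inverses are described by equations since they exist only for
    some elements of [U]. *)
Definition adjoint_subgroup H : Prop :=
  [/\ H 1, forall x y, H x -> H y -> H (x * y),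
      forall x y, H x -> x * y = 1 -> y * x = 1 -> H y &
      forall x, H x -> J (x - 1)].

Hypotheses (radJ : radical_ideal) (accJ : no_ascending adjoint_subgroup).

Let gJ : add_subgroup J. Proof. by case: radJ => - []. Qed.

Let JMl a x : J x -> J (a * x). Proof. by move/(radJ.1.2 a) => []. Qed.

Let JMr a x : J x -> J (x * a). Proof. by move/(radJ.1.2 a) => []. Qed.

Let comm_int a : commr_rmorph (intr : int -> U) a.
Proof. by move=> n; apply: commr_int. Qed.

Let ev a : {poly int} -> U := horner_morph (comm_int a).

Let evX a : ev a 'X = a. Proof. exact: horner_morphX. Qed.

Let evC a c : ev a c%:P = c%:~R. Proof. exact: horner_morphC. Qed.

Let evM a G G' : ev a (G * G') = ev a G * ev a G'. Proof. exact: rmorphM. Qed.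

Let evD a G G' : ev a (G + G') = ev a G + ev a G'. Proof. exact: rmorphD. Qed.

Let evB a G G' : ev a (G - G') = ev a G - ev a G'. Proof. exact: rmorphB. Qed.

Let ev_comm a G G' : ev a G * ev a G' = ev a G' * ev a G.
Proof. by rewrite -!evM mulrC. Qed.

Let ev1 a : ev a 1 = 1. Proof. exact: rmorph1. Qed.

Let evJ a G : J a -> J (ev a ('X * G)).
Proof. by move=> Ja; rewrite evM evX; apply: JMr. Qed.

Let ev_exp a G n : ev a (G ^+ n) = ev a G ^+ n. Proof. exact: rmorphXn. Qed.

Let evX_exp a n : a ^+ n = ev a 'X^n. Proof. by rewrite ev_exp evX. Qed.

Let euclid_relation a : J a -> exists n A B,
  [/\ euclid_monoid n A, euclid_monoid n B & ev a (euclid_poly n * A - B) = 0].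
Proof.
move=> Ja; apply: contrapT => norel; apply: accJ.
(* The [n]-th subgroup consists of the fractions B(a) / A(a) in 1 + [J]. Without a relation, the
   value of [euclid_poly n] at [a] is in the next subgroup but not in this one. *)
exists (fun n => [set x | J (x - 1) /\
  exists A B, [/\ euclid_monoid n A, euclid_monoid n B & x * ev a A = ev a B]]).
move=> n; split; first split.
- split; first by rewrite subrr; case: gJ.
  by exists 1, 1; rewrite mul1r; split=> //; apply: euclid_monoid1.
- move=> x y [Jx [A [B [TA TB xA]]]] [Jy [A' [B' [TA' TB' yA]]]].
  split.
    rewrite (_ : x * y - 1 = (x - 1) * y + (y - 1)).
      by apply: add_subgroupD => //; apply: JMr.
    by rewrite mulrBl mul1r addrA subrK.
  exists (A' * A), (B * B'); split; try exact: euclid_monoidM.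
  rewrite !evM mulrA -(mulrA x) yA -mulrA (ev_comm a B') mulrA.
  by congr (_ * _).
- move=> x y [Jx [A [B [TA TB xA]]]] xy yx; split.
    rewrite (_ : y - 1 = - (y * (x - 1))); last by rewrite mulrBr yx mulr1 opprB.
    by apply: add_subgroupN => //; apply: JMl.
  by exists B, A; split=> //; rewrite -xA mulrA yx mul1r.
- by move=> x [].
split.
  move=> x [Jx [A [B [TA TB xA]]]]; split=> //.
  by exists A, B; split=> //; apply: euclid_monoidS.
move=> /(_ (ev a (euclid_poly n))) [].
  split; first by rewrite evD ev1 addrC addKr; apply: evJ.
  exists 1, (euclid_poly n); rewrite ev1 mulr1.
  by split=> //; [apply: euclid_monoid1 | apply: euclid_monoid_last].
move=> _ [A [B [TA TB eqAB]]]; apply: norel; exists n, A, B; split=> //.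
by rewrite evB evM eqAB subrr.
Qed.

(** Multiplying the relation by [a] kills its part divisible by [p]. As [c] is invertible modulo
    [p], what remains is a^(k+1) times an element of 1 + [J], which is a unit. *)
Lemma nilpotent_ptorsion p a : prime p -> J a -> a *+ p = 0 ->
  exists n, a ^+ n = 0.
Proof.
move=> p_pr Ja pa0; have [n [A [B [_ TB]]]] := euclid_relation Ja.
have [k [c [g [H [pc ->]]]]] :=
  poly_int_lowest_mod (euclid_relation_coef_prime A p_pr TB).
have [u [v uvE]] := bezout_primez p_pr pc.
have paE G : ev a ('X * (p%:Z%:P * G)) = 0.
  by rewrite mulrCA !evM evC evX mulrA mulrzl -pmulrn pa0 mul0r.
rewrite evD => /(canRL (addrK _)); rewrite sub0r => eq0.
have [y y1 _] := radJ.2 _ (evJ (v%:P * g) Ja).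
exists k.+1; rewrite -[a ^+ _]mulr1 -y1 mulrA.
suff -> : a ^+ k.+1 * (1 + ev a ('X * (v%:P * g))) = 0 by rewrite mul0r.
have uv1 : 1 = u%:P * p%:Z%:P + v%:P * c%:P :> {poly int}.
  by rewrite -!polyCM -polyCD uvE.
have -> : a ^+ k.+1 * (1 + ev a ('X * (v%:P * g))) =
    ev a ('X * v%:P * ('X^k * (c%:P + 'X * g)) + 'X * (p%:Z%:P * ('X^k * u%:P))).
  rewrite evX_exp -{1}(ev1 a) -evD -evM; congr ev.
  by rewrite [in LHS]uv1 exprS; ring.
rewrite evD paE addr0 evM eq0 mulrN -evM.
by rewrite -mulrA [v%:P * _]mulrCA paE oppr0.
Qed.

(** The relation makes t = b^(2K) satisfy t t = N t with N > 0. A second relation F(t) = 0 then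
    gives F(N) t = 0 with F(N) nonzero, so t = 0; since [t] acts on a^K as [N], a^K = 0. *)
Lemma nilpotent_torsionfree a :
    (forall x n, J x -> (0 < n)%N -> x *+ n = 0 -> x = 0) -> J a ->
  exists n, a ^+ n = 0.
Proof.
move=> tfJ Ja; have [n [A [B [_ TB]]]] := euclid_relation Ja.
(* Modulus 0: the relation is a nonzero polynomial, as its value at 1 is nonzero. *)
have [|k [c [g [H [c_nz ->]]]]] :=
    @poly_int_lowest_mod 0 (euclid_poly n * A - B).
  apply: contrapT => allz; have /eqP[] := euclid_relation_horner A TB ltr01.
  rewrite (_ : _ - _ = 0) ?horner0 //; apply/polyP => i; rewrite coef0.
  by apply: contrapT => /eqP nz; apply: allz; exists i; rewrite dvd0z.
rewrite dvd0z in c_nz; rewrite mul0r addr0 => eq0.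
(* The even exponent makes [N] positive. *)
pose K := k.+1; pose b := - ('X * g); pose t := ev a (b ^+ K.*2).
pose N : int := c ^+ K.*2.
have N_gt0 : 0 < N by rewrite exprn_even_gt0 ?odd_double ?c_nz ?orbT.
(* On multiples of a^K the element b acts as the integer c. *)
have bK G : ev a (b * ('X ^+ K * G)) = ev a ('X ^+ K * G) *~ c.
  apply/eqP; rewrite -subr_eq0 -mulrzr -(evC a) -evM -evB.
  rewrite (_ : _ - _ = 'X^k * (c%:P + 'X * g) * (- ('X * G))).
    by rewrite evM eq0 mul0r.
  by rewrite /b /K exprS; ring.
have bKn m G : ev a (b ^+ m * ('X ^+ K * G)) = ev a ('X ^+ K * G) *~ (c ^+ m).
  elim: m => [|m IHm]; first by rewrite mul1r.
  rewrite exprS -mulrA [b ^+ m * _]mulrCA bK ['X^_ * _]mulrCA IHm.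
  by rewrite -mulrzA -exprSr.
have tE : b ^+ K.*2 = 'X ^+ K * ('X ^+ K * (- g) ^+ K.*2).
  by rewrite /b -mulrN exprMn -addnn !exprD; ring.
have tt : t * t = t *~ N by rewrite /t -evM {2 3}tE bKn.
have Jt : J t by rewrite /t tE /K exprS -mulrA; apply: evJ.
have [n' [A' [B' [_ TB' eq0']]]] := euclid_relation Jt.
have evt G : ev t G * t = t *~ G.[N].
  elim/poly_ind: G => [|G d IHG].
    by rewrite /ev rmorph0 mul0r horner0 mulr0z.
  rewrite evD evM evX evC hornerMXaddC mulrDl -mulrA tt mulrzl mulrzDr.
  by rewrite mulrzAr IHG -mulrzA.
have Jn0 x (m : int) : J x -> m != 0 -> x *~ m = 0 -> x = 0.
  move=> Jx m_nz xm; apply: (tfJ x (absz m)) => //; first by rewrite absz_gt0.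
  by rewrite pmulrn abszEsg mulrC mulrzA xm mul0rz.
have t0 : t = 0.
  apply: (Jn0 t _ Jt (euclid_relation_horner A' TB' N_gt0)).
  by rewrite -evt eq0' mul0r.
exists K; apply: (Jn0 _ N); last 1 first.
- have := bKn K.*2 1; rewrite mulr1 evM -/t t0 mul0r => /esym.
  by rewrite ev_exp evX.
- by rewrite /K exprS; apply: JMr.
- by rewrite gt_eqF.
Qed.

(* The element [a] is chosen with maximal left annihilator (Utumi's proof of  *)
(* Levitzki's theorem).                                                       *)
Lemma nil_ideal_sandwich W : ring_ideal W -> W `<=` J ->
    (forall x, W x -> exists n, x ^+ n = 0) -> (exists2 x, W x & x != 0) ->
  exists a, [/\ W a, a != 0 & forall w, W w -> a * w * a = 0].
Proof.
move=> [gW WM] sWJ nilW [x0 Wx0 nz_x0].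
(* The left annihilator of [a] in [W], shifted by 1 to become an adjoint subgroup. *)
pose ann a : set U := [set x | W (x - 1) /\ (x - 1) * a = 0].
pose Q H := exists a, [/\ W a, a != 0 & H = ann a].
have [||H [a [Wa nz_a ->]] Hmax] := maximal_no_ascending (Q := Q) accJ.
- move=> H [a [Wa nz_a ->]]; split.
  + by rewrite /ann /= subrr mul0r; split=> //; case: gW.
  + move=> x y [Wx xa] [Wy ya].
    have xyE : x * y - 1 = (x - 1) * (y - 1) + (x - 1) + (y - 1).
      by rewrite mulrBr mulr1 subrK mulrBl mul1r addrA subrK.
    rewrite /ann /= xyE; split.
      by do 2?[apply: add_subgroupD => //]; case: (WM (x - 1) (y - 1) Wy).
    by rewrite mulrDl ya addr0 mulrDl xa addr0 -mulrA ya mulr0.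
  + move=> x y [Wx xa] xy yx.
    have yE : y - 1 = - (y * (x - 1)) by rewrite mulrBr yx mulr1 opprB.
    rewrite /ann /= yE mulNr -mulrA xa mulr0 oppr0; split=> //.
    by apply: add_subgroupN => //; case: (WM y (x - 1) Wx).
  + by move=> x [/sWJ].
- by exists (ann x0), x0.
exists a; split=> // w Ww; apply: contrapT => /eqP nz_awa.
have nz_aw : a * w != 0 by apply: contraNneq nz_awa => ->; rewrite mul0r.
have [n awn] := nilW (a * w) (WM w a Wa).2.
(* The last nonzero power of a w is a right multiple of [a], so by maximality it has the same left
   annihilator as [a]. That annihilator contains a w. *)
have [m [awm awmS]] : exists m, (a * w) ^+ m.+1 != 0 /\ (a * w) ^+ m.+2 = 0.
  apply: contrapT => nex.
  have: forall m, (a * w) ^+ m.+1 != 0.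
    elim=> [|m IHm]; first by rewrite expr1.
    by apply/eqP => aw0; apply: nex; exists m.
  move/(_ n); rewrite exprS awn mulr0 eqxx //.
have zE : (a * w) ^+ m.+1 = a * (w * (a * w) ^+ m) by rewrite exprS mulrA.
have Wz : W ((a * w) ^+ m.+1) by rewrite zE; case: (WM (w * (a * w) ^+ m) a Wa).
have [|||_ aw0] := Hmax (ann ((a * w) ^+ m.+1)) _ _ (a * w + 1).
- by exists ((a * w) ^+ m.+1).
- by move=> x [Wx xa]; split=> //; rewrite zE [LHS]mulrA xa mul0r.
- by rewrite /ann /= addrK -exprS awmS; split=> //; case: (WM w a Wa).
by move: nz_awa; rewrite -[a * w](addrK 1) aw0 eqxx.
Qed.

End RadicalIdeals.

(** * Skew braces, ideals and quotients *)

Section SkewBraceTheory.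
Variable A : skewBraceType.
Local Open Scope brace_scope.
Implicit Types a b c x y z : A.

Lemma brace_addK x y : x + y - y = x.
Proof. exact: (@mulgK (add_group A) y x). Qed.

Lemma brace_subK x y : x - y + y = x.
Proof. exact: (@mulgVK (add_group A) y x). Qed.

Lemma brace_addNKl x y : x + (- x + y) = y.
Proof. exact: (@mulVKg (add_group A) x y). Qed.

Lemma brace_oppD x y : - (x + y) = - y - x.
Proof. exact: (@invgM (add_group A) x y). Qed.

Lemma brace_oppK x : - (- x) = x.
Proof. exact: (@invgK (add_group A) x). Qed.

Lemma brace_opp0 : - (0 : A) = 0.
Proof. exact: (@invg1 (add_group A)). Qed.

Lemma brace_addI x y z : x + y = x + z -> y = z.
Proof. exact: (@mulgI (add_group A) x y z). Qed.

Lemma brace_addIr x y z : y + x = z + x -> y = z.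
Proof. exact: (@mulIg (add_group A) x y z). Qed.

Lemma brace_zero1 : (0 : A) = 1%g.
Proof.
have := brace_circD (1%g : A) 0 0.
rewrite brace_add0l mul1g brace_add0l brace_add0r => /(congr1 brace_opp).
by rewrite brace_oppK brace_opp0.
Qed.

Definition lam a b : A := - a + a ∘ b.

Definition rho c a : A := a ∘ c - c.

Lemma circ_lam a b : a ∘ b = a + lam a b.
Proof. by rewrite brace_addNKl. Qed.

Lemma circ_rho a b : a ∘ b = rho b a + b.
Proof. by rewrite brace_subK. Qed.

Lemma star_lam a b : star a b = lam a b - b. Proof. by []. Qed.

Lemma star_rho a b : star a b = - a + rho b a.
Proof. by rewrite /star -brace_addA. Qed.

Lemma lamD a b c : lam a (b + c) = lam a b + lam a c.
Proof. by rewrite /lam brace_circD !brace_addA. Qed.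

Lemma lam0 a : lam a 0 = 0.
Proof. by apply: (@brace_addI (lam a 0)); rewrite -lamD !brace_add0r. Qed.

Lemma lamN a b : lam a (- b) = - lam a b.
Proof. by apply: (@brace_addI (lam a b)); rewrite -lamD !brace_addNr lam0. Qed.

Lemma lam1 b : lam 1%g b = b.
Proof. by rewrite /lam mul1g -brace_zero1 brace_opp0 brace_add0l. Qed.

Lemma lamM a b c : lam (a ∘ b) c = lam a (lam b c).
Proof.
rewrite {3}/lam lamD lamN /lam brace_oppD brace_oppK -brace_addA.
by rewrite brace_addNKl mulgA.
Qed.

Lemma lamK a : cancel (lam a) (lam a^-1%g).
Proof. by move=> b; rewrite -lamM mulVg lam1. Qed.

Lemma lamVK a : cancel (lam a^-1%g) (lam a).
Proof. by move=> b; rewrite -lamM mulgV lam1. Qed.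

Definition ideal (K : set A) : Prop :=
  [/\ K 0, forall x y, K x -> K y -> K (x - y),
      forall a x, K x -> K (a + x - a),
      forall a x, K x -> K (lam a x) & forall a x, K x -> K (rho a x)].

Section TwoSided.
Hypothesis two_sidedA : two_sided A.

Lemma rhoD c a b : rho c (a + b) = rho c a + rho c b.
Proof. by rewrite /rho two_sidedA !brace_addA. Qed.

Lemma rho0 c : rho c 0 = 0.
Proof. by rewrite /rho brace_zero1 mul1g brace_addNr brace_zero1. Qed.

Lemma rhoN c a : rho c (- a) = - rho c a.
Proof. by apply: (@brace_addI (rho c a)); rewrite -rhoD !brace_addNr rho0. Qed.

Lemma rho1 b : rho 1%g b = b.
Proof. by rewrite /rho mulg1 -brace_zero1 brace_opp0 brace_add0r. Qed.

Lemma rhoM a b c : rho (b ∘ c) a = rho c (rho b a).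
Proof.
rewrite {3}/rho rhoD rhoN /rho brace_oppD brace_oppK brace_addA.
by rewrite brace_subK mulgA.
Qed.

Lemma rhoK a : cancel (rho a) (rho a^-1%g).
Proof. by move=> b; rewrite -rhoM mulgV rho1. Qed.

Lemma rhoVK a : cancel (rho a^-1%g) (rho a).
Proof. by move=> b; rewrite -rhoM mulVg rho1. Qed.

End TwoSided.

Section Ideals.
Variables (K : set A) (idK : ideal K).

Lemma ideal0 : K 0. Proof. by case: idK. Qed.

Lemma idealN x : K x -> K (- x).
Proof. by case: idK => K0 KB _ _ _ Kx; rewrite -[- x]brace_add0l; apply: KB. Qed.

Lemma idealD x y : K x -> K y -> K (x + y).
Proof.
case: idK => _ KB _ _ _ Kx Ky; rewrite -[y]brace_oppK; apply: KB => //.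
exact: idealN.
Qed.

Lemma idealJ a x : K x -> K (a + x - a).
Proof. by case: idK => _ _ + _ _; apply. Qed.

Lemma ideal_lam a x : K x -> K (lam a x).
Proof. by case: idK => _ _ _ + _; apply. Qed.

Lemma ideal_rho a x : K x -> K (rho a x).
Proof. by case: idK => _ _ _ _; apply. Qed.

Lemma ideal_subgroup : @subgroup (add_group A) K.
Proof. by split; [exact: ideal0 | exact: idealD | exact: idealN]. Qed.

Lemma ideal_circ_subgroup : @subgroup (circ_group A) K.
Proof.
split; first by have := ideal0; rewrite brace_zero1.
  by move=> x y Kx Ky; rewrite [(_ * _)%g]circ_lam; apply/idealD/ideal_lam.
(* The circle inverse of [x] is the image of [- x] under [lam x^-1]. *)
move=> x Kx; have /(congr1 (lam x^-1%g)) : lam x x^-1%g = - x.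
  by rewrite /lam mulgV -brace_zero1 brace_add0r.
by rewrite lamK => ->; apply/ideal_lam/idealN.
Qed.

End Ideals.
End SkewBraceTheory.

(** * Quotients of two-sided skew braces by ideals *)

Section Quotient.
Variables (A : skewBraceType) (K : set A) (two_sidedA : two_sided A).
Hypothesis idK : ideal K.
Local Open Scope brace_scope.
Implicit Types a b c x y z : A.

Definition eq_mod x y : bool := `[< K (x - y) >].

Let eq_mod_refl : reflexive eq_mod.
Proof. by move=> x; apply/asboolP; rewrite brace_addNr; apply: ideal0 idK. Qed.

Let eq_mod_sym : symmetric eq_mod.
Proof.
have sub x y : eq_mod x y -> eq_mod y x.
  move=> /asboolP/(idealN idK) Kxy; apply/asboolP.
  by move: Kxy; rewrite brace_oppD brace_oppK.
by move=> x y; apply/idP/idP; apply: sub.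
Qed.

Let eq_mod_trans : transitive eq_mod.
Proof.
move=> y x z /asboolP Kxy /asboolP Kyz; apply/asboolP.
by have := idealD idK Kxy Kyz; rewrite brace_addA brace_subK.
Qed.

Definition eq_mod_equiv := EquivRel eq_mod eq_mod_refl eq_mod_sym eq_mod_trans.

(* The brace structure depends on the two-sidedness of [A], so the carrier    *)
(* must mention it for the structure to be inferred from the type.            *)
Definition brace_quotient : Type :=
  let _ := two_sidedA in {eq_quot eq_mod_equiv}%qT.

HB.instance Definition _ :=
  Choice.copy brace_quotient {eq_quot eq_mod_equiv}%qT.

Definition quotient_map : A -> brace_quotient := \pi_({eq_quot eq_mod_equiv})%qT.
Local Notation pi := quotient_map.

Lemma quotient_mapP x y : pi x = pi y <-> K (x - y).
Proof.
split=> [/eqP|Kxy]; first by rewrite eqquotE => /asboolP.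
by apply/eqP; rewrite eqquotE; apply/asboolP.
Qed.

Lemma quotient_map_surj (u : brace_quotient) : exists x, pi x = u.
Proof. by exists (repr u); rewrite /pi reprK. Qed.

Let piK x : K (repr (pi x) - x).
Proof. by apply/quotient_mapP; rewrite /pi reprK. Qed.

Let ideal_congrD x x' y y' : K (x - x') -> K (y - y') -> K ((x + y) - (x' + y')).
Proof.
move=> Kx /(idealJ idK x) Ky; have := idealD idK Ky Kx.
by rewrite brace_oppD !brace_addA brace_subK.
Qed.

Let ideal_congrN x x' : K (x - x') -> K (- x - - x').
Proof.
move=> /(idealN idK)/(idealJ idK (- x)).
by rewrite brace_oppD !brace_oppK !brace_addA brace_subK.
Qed.

(** Passing through x ∘ y', the difference is the conjugate by [x] of [lam x (y - y')] plus
    [rho y' (x - x')]. *)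
Let ideal_congrM x x' y y' : K (x - x') -> K (y - y') -> K (x ∘ y - x' ∘ y').
Proof.
move=> /(ideal_rho idK y') + /(ideal_lam idK x)/(idealJ idK x).
rewrite (rhoD two_sidedA) (rhoN two_sidedA) lamD lamN => Kx Ky.
have rhoE : rho y' x = x + lam x y' - y' by rewrite -circ_lam.
have := idealD idK Ky Kx; rewrite [x ∘ y]circ_lam [x' ∘ y']circ_rho rhoE.
move: (lam x y) (lam x y') (rho y' x') => l l' r.
by rewrite brace_oppD !brace_addA !brace_subK.
Qed.

Let ideal_congrV x x' : K (x - x') -> K (x^-1%g - x'^-1%g).
Proof.
move=> Kx; have Krefl z : K (z - z) by rewrite brace_addNr; apply: ideal0 idK.
have := ideal_congrM (Krefl x'^-1%g) (ideal_congrM Kx (Krefl x^-1%g)).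
rewrite mulgV mulg1 mulgA mulVg mul1g => /(idealN idK).
by rewrite brace_oppD brace_oppK.
Qed.

Let qadd (u v : brace_quotient) := pi (repr u + repr v).
Let qopp (u : brace_quotient) := pi (- repr u).
Let qmul (u v : brace_quotient) := pi (repr u ∘ repr v).
Let qinv (u : brace_quotient) := pi (repr u)^-1%g.

Let piD x y : qadd (pi x) (pi y) = pi (x + y).
Proof. by apply/quotient_mapP/ideal_congrD; apply: piK. Qed.

Let piN x : qopp (pi x) = pi (- x).
Proof. by apply/quotient_mapP/ideal_congrN; apply: piK. Qed.

Let piM x y : qmul (pi x) (pi y) = pi (x ∘ y).
Proof. by apply/quotient_mapP/ideal_congrM; apply: piK. Qed.

Let piV x : qinv (pi x) = pi x^-1%g.
Proof. by apply/quotient_mapP/ideal_congrV; apply: piK. Qed.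

Local Ltac lift u := case: (quotient_map_surj u) => ? <-.

Let qmulA : associative qmul.
Proof. by move=> u v w; lift u; lift v; lift w; rewrite !piM mulgA. Qed.

Let qmul1 : left_id (pi 1%g) qmul.
Proof. by move=> u; lift u; rewrite piM mul1g. Qed.

Let qmulr1 : right_id (pi 1%g) qmul.
Proof. by move=> u; lift u; rewrite piM mulg1. Qed.

Let qmulV : left_inverse (pi 1%g) qinv qmul.
Proof. by move=> u; lift u; rewrite piV piM mulVg. Qed.

Let qmulrV : right_inverse (pi 1%g) qinv qmul.
Proof. by move=> u; lift u; rewrite piV piM mulgV. Qed.

HB.instance Definition _ :=
  isGroup.Build brace_quotient qmulA qmul1 qmulr1 qmulV qmulrV.

HB.instance Definition _ := hasBraceAdd.Build brace_quotient qadd (pi 0) qopp.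

Let qaddA u v w : qadd u (qadd v w) = qadd (qadd u v) w.
Proof. by lift u; lift v; lift w; rewrite !piD brace_addA. Qed.

Let qadd0l u : qadd (pi 0) u = u.
Proof. by lift u; rewrite piD brace_add0l. Qed.

Let qadd0r u : qadd u (pi 0) = u.
Proof. by lift u; rewrite piD brace_add0r. Qed.

Let qaddNl u : qadd (qopp u) u = pi 0.
Proof. by lift u; rewrite piN piD brace_addNl. Qed.

Let qaddNr u : qadd u (qopp u) = pi 0.
Proof. by lift u; rewrite piN piD brace_addNr. Qed.

Let qcircD u v w : qmul u (qadd v w) = qadd (qadd (qmul u v) (qopp u)) (qmul u w).
Proof. by lift u; lift v; lift w; rewrite !(piN, piD, piM) brace_circD. Qed.

HB.instance Definition _ :=
  isSkewBrace.Build brace_quotient qaddA qadd0l qadd0r qaddNl qaddNr qcircD.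

Lemma quotient_mapD x y : pi (x + y) = pi x + pi y.
Proof. by rewrite -piD. Qed.

Lemma quotient_mapM x y : pi (x ∘ y) = pi x ∘ pi y.
Proof. by rewrite -piM. Qed.

End Quotient.

(** * Adjoining a unit to a quasi-regular ring *)

Section Unitization.
Variables (M : zmodType) (mulm : M -> M -> M).
Hypotheses (mulmA : associative mulm)
  (mulmDl : left_distributive mulm +%R) (mulmDr : right_distributive mulm +%R).

(* The ring structure below depends on [mulm] and on its properties, so the   *)
(* carrier must mention them for the structure to be inferred from the type.  *)
Definition unitization : Type :=
  let _ := (mulmA, mulmDl, mulmDr) in (int * M)%type.

HB.instance Definition _ := GRing.Zmodule.copy unitization (int * M)%type.

Let mulm0 x : mulm x 0 = 0.
Proof. by apply: (addrI (mulm x 0)); rewrite -mulmDr !addr0. Qed.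

Let mul0m x : mulm 0 x = 0.
Proof. by apply: (addrI (mulm 0 x)); rewrite -mulmDl !addr0. Qed.

Let mulmN x y : mulm x (- y) = - mulm x y.
Proof. by apply: (addrI (mulm x y)); rewrite -mulmDr !subrr mulm0. Qed.

Let mulNm x y : mulm (- x) y = - mulm x y.
Proof. by apply: (addrI (mulm x y)); rewrite -mulmDl !subrr mul0m. Qed.

Let mulmMn x y n : mulm x (y *+ n) = mulm x y *+ n.
Proof. by elim: n => [|n IHn]; rewrite ?mulm0 // !mulrS mulmDr IHn. Qed.

Let mulMnm x y n : mulm (x *+ n) y = mulm x y *+ n.
Proof. by elim: n => [|n IHn]; rewrite ?mul0m // !mulrS mulmDl IHn. Qed.

Let mulmMz x y (n : int) : mulm x (y *~ n) = mulm x y *~ n.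
Proof. by case: n => n; rewrite ?mulmMn // NegzE !mulrNz mulmN mulmMn. Qed.

Let mulMzm x y (n : int) : mulm (x *~ n) y = mulm x y *~ n.
Proof. by case: n => n; rewrite ?mulMnm // NegzE !mulrNz mulNm mulMnm. Qed.

Definition umul (u v : unitization) : unitization :=
  (u.1 * v.1, u.2 *~ v.1 + v.2 *~ u.1 + mulm u.2 v.2).

Let umulA : associative umul.
Proof.
move=> [m x] [n y] [k z]; congr (_, _) => /=; first exact: mulrA.
rewrite !(mulmDl, mulmDr, mulmMz, mulMzm, mulrzDl) -!mulrzA mulmA.
rewrite [n * k]mulrC [k * m]mulrC [n * m]mulrC.
move: (x *~ _) (y *~ _) (z *~ _) (mulm y z *~ m) (mulm x y *~ k) (mulm x z *~ n).
by move=> a b c d e f; rewrite (AC (1*3*3) (1*2*5*3*(6*4*7))).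
Qed.

Let umul1 : left_id ((1, 0) : unitization) umul.
Proof. by move=> [m x]; rewrite /umul /= mul1r mul0rz mul0m add0r addr0. Qed.

Let umulr1 : right_id ((1, 0) : unitization) umul.
Proof. by move=> [m x]; rewrite /umul /= mulr1 mul0rz mulm0 !addr0. Qed.

Let umulDl : left_distributive umul +%R.
Proof.
move=> [m x] [n y] [k z]; congr (_, _) => /=; first exact: mulrDl.
by rewrite mulrzDl mulrzDr mulmDl (AC (2*2*2) ((1*3*5)*(2*4*6))).
Qed.

Let umulDr : right_distributive umul +%R.
Proof.
move=> [m x] [n y] [k z]; congr (_, _) => /=; first exact: mulrDr.
by rewrite mulrzDl mulrzDr mulmDr (AC (2*2*2) ((1*3*5)*(2*4*6))).
Qed.

Let uone_neq0 : ((1, 0) : unitization) != 0.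
Proof. by apply/eqP => -[]. Qed.

HB.instance Definition _ := GRing.Zmodule_isNzRing.Build unitization
  umulA umul1 umulr1 umulDl umulDr uone_neq0.


Let U : nzRingType := unitization.
Let inj (x : M) : U := (0, x).

Let injM x y : inj x * inj y = inj (mulm x y).
Proof. by congr (_, _); rewrite /= !mulr0z !add0r. Qed.

Let injD x y : inj x + inj y = inj (x + y).
Proof. by congr (_, _) => /=; rewrite addr0. Qed.

Let injB x y : inj x - inj y = inj (x - y).
Proof. by congr (_, _) => /=; rewrite subr0. Qed.

Let injMn x n : inj x *+ n = inj (x *+ n).
Proof. by elim: n => // n IHn; rewrite !mulrS IHn injD. Qed.

Let inj_inj : injective inj. Proof. by move=> x y []. Qed.

Let add1inj x y : (1 + inj x) * (1 + inj y) = 1 + inj (x + y + mulm x y).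
Proof.
by rewrite mulrDl mul1r mulrDr mulr1 injM -addrA !injD [y + _]addrCA addrA.
Qed.

(** The adjoint subgroups of the unitization, transported to [M] along x -> 1 + x. *)
Definition quasi_subgroup (H : set M) : Prop :=
  [/\ H 0, forall x y, H x -> H y -> H (x + y + mulm x y) &
      forall x y, H x -> x + y + mulm x y = 0 -> y + x + mulm y x = 0 -> H y].

Lemma quasi_regular_sandwich W :
    (forall x, exists2 y, x + y + mulm x y = 0 & y + x + mulm y x = 0) ->
    no_ascending quasi_subgroup -> add_subgroup W ->
    (forall x y, W y -> W (mulm x y) /\ W (mulm y x)) ->
    (exists2 x, W x & x != 0) ->
    (exists2 p, prime p & forall x, W x -> x *+ p = 0) \/
      (forall (x : M) n, (0 < n)%N -> x *+ n = 0 -> x = 0) ->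
  exists a, [/\ W a, a != 0 & forall w, W w -> mulm (mulm a w) a = 0].
Proof.
move=> quasiM accM gW WM [x0 Wx0 nz_x0] tors.
have ideal_inj V : add_subgroup V ->
    (forall x y, V y -> V (mulm x y) /\ V (mulm y x)) ->
    @ring_ideal U (inj @` V).
  move=> gV VM; split.
    split; first by exists 0; [case: gV | ].
    move=> _ _ [x Vx <-] [y Vy <-]; exists (x - y); first exact: gV.2.
    by rewrite injB.
  move=> [m x] _ [y Vy <-]; have [Vxy Vyx] := VM x y Vy.
  split; [exists (y *~ m + mulm x y) | exists (y *~ m + mulm y x)].
  - by apply: add_subgroupD => //; apply: add_subgroupMz.
  - by congr (_, _); rewrite /= ?mulr0 // mulr0z add0r.
  - by apply: add_subgroupD => //; apply: add_subgroupMz.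
  - by congr (_, _); rewrite /= ?mul0r // mulr0z addr0.
pose J : set U := inj @` setT.
have gT : add_subgroup [set: M] by [].
have radJ : radical_ideal J.
  split; first exact: ideal_inj.
  move=> _ [x _ <-]; have [y xy yx] := quasiM x; exists (1 + inj y).
    by rewrite add1inj xy; congr (_, _); rewrite /= addr0.
  by rewrite add1inj yx; congr (_, _); rewrite /= addr0.
have one0 : 1 + inj 0 = 1 by congr (_, _); rewrite /= addr0.
have accJ : no_ascending (adjoint_subgroup J).
  move=> [H HP]; apply: accM; exists (fun n => [set x | H n (1 + inj x)]) => n.
  have [[H1 HM HV HJ] [sH nsH]] := HP n; split; first split.
  - by rewrite /= one0.
  - by move=> x y Hx Hy; rewrite /= -add1inj; apply: HM.
  - move=> x y Hx xy yx; apply: (HV _ _ Hx); rewrite add1inj ?xy ?yx ?one0 //.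
  split=> [x Hx|sH']; first exact: sH.
  apply: nsH => u Hu; have [[_ _ _ HJ'] _] := HP n.+1.
  have [x _ /eqP] := HJ' u Hu; rewrite eq_sym subr_eq addrC => /eqP uE.
  by rewrite uE; apply: sH'; rewrite /= -uE.
have inj_nz x : x != 0 -> inj x != 0 by apply: contraNneq => -[->].
have [||||_ [[a Wa <-] nz_a aWa]] := nil_ideal_sandwich (W := inj @` W) accJ.
- exact: ideal_inj.
- by move=> _ [x _ <-]; exists x.
- move=> _ [x Wx <-]; have Jx : J (inj x) by exists x.
  case: tors => [[p p_pr pW]|tf].
    by apply: (nilpotent_ptorsion radJ accJ p_pr Jx); rewrite injMn pW.
  apply: (nilpotent_torsionfree radJ accJ) => // _ n [y _ <-] n_gt0.
  by rewrite injMn => /inj_inj/(tf _ _ n_gt0) ->.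
- by exists (inj x0); [exists x0 | apply: inj_nz].
exists a; split=> // w Ww; have := aWa (inj w) (ex_intro2 _ _ w Ww erefl).
by rewrite !injM => /inj_inj.
Qed.

End Unitization.

(** * The centre of the additive group as a bimodule *)

Lemma no_ascending_image T S (f : T -> S) (P : set S -> Prop) : injective f ->
  no_ascending P -> no_ascending (fun H => P (f @` H)).
Proof.
move=> injf accP [H HP]; apply: accP; exists (fun n => f @` H n) => n.
have [PH [sH nsH]] := HP n; split=> //; split; first exact: image_subset.
move=> sH'; apply: nsH => x Hx; have [|y Hy /injf <- //] := sH' (f x).
by exists x.
Qed.

Section Center.
Variable A : skewBraceType.
Hypothesis two_sidedA : two_sided A.
Local Open Scope brace_scope.
Implicit Types a b c : A.

Definition add_center : set A := [set z | forall a, a + z = z + a].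

Lemma add_centerB (x y : A) : add_center x -> add_center y -> add_center (x - y).
Proof.
move=> cx cy a; rewrite brace_addA cx -!brace_addA; congr (_ + _).
by apply: (@brace_addI _ y); rewrite brace_addNKl brace_addA -cy brace_addK.
Qed.

Lemma ideal_add_center : ideal add_center.
Proof.
split.
- by move=> a; rewrite brace_add0l brace_add0r.
- exact: add_centerB.
- by move=> a x cx; rewrite cx brace_addK.
- move=> a x cx b; rewrite -[b](lamVK a) -!lamD cx //.
- by move=> a x cx b; rewrite -[b](rhoVK two_sidedA a) -!(rhoD two_sidedA) cx.
Qed.

Definition center_type : Type := {z : A | `[< add_center z >]}.

HB.instance Definition _ := Choice.on center_type.

Implicit Types u v w : center_type.

Definition to_center (z : A) (cz : add_center z) : center_type :=
  exist _ z (asboolT cz).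

Lemma center_typeP u : add_center (sval u). Proof. exact/asboolP/(svalP u). Qed.

Let cen_inj : injective (fun u : center_type => sval u).
Proof. by move=> u v; apply: val_inj. Qed.

Definition cen_add u v : center_type :=
  to_center (idealD ideal_add_center (center_typeP u) (center_typeP v)).
Definition cen_opp u : center_type :=
  to_center (idealN ideal_add_center (center_typeP u)).
Definition cen_zero : center_type := to_center (ideal0 ideal_add_center).

Let cen_addA : associative cen_add.
Proof. by move=> u v w; apply/cen_inj/brace_addA. Qed.

Let cen_addC : commutative cen_add.
Proof. by move=> u v; apply/cen_inj/center_typeP. Qed.

Let cen_add0 : left_id cen_zero cen_add.
Proof. by move=> u; apply/cen_inj/brace_add0l. Qed.

Let cen_addN : left_inverse cen_zero cen_opp cen_add.
Proof. by move=> u; apply/cen_inj/brace_addNl. Qed.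

HB.instance Definition _ := GRing.isZmodule.Build center_type
  cen_addA cen_addC cen_add0 cen_addN.

Definition cen_lam a u : center_type :=
  to_center (ideal_lam ideal_add_center a (center_typeP u)).

Definition cen_rho a u : center_type :=
  to_center (ideal_rho ideal_add_center a (center_typeP u)).

Let cen_lamD a u v : cen_lam a (u + v)%R = (cen_lam a u + cen_lam a v)%R.
Proof. exact/cen_inj/lamD. Qed.

Let cen_rhoD a u v : cen_rho a (u + v)%R = (cen_rho a u + cen_rho a v)%R.
Proof. exact/cen_inj/rhoD. Qed.

Let cen_lamM a b u : cen_lam (a ∘ b) u = cen_lam a (cen_lam b u).
Proof. exact/cen_inj/lamM. Qed.

Let cen_rhoM a b u : cen_rho (a ∘ b) u = cen_rho b (cen_rho a u).
Proof. exact/cen_inj/rhoM. Qed.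

(** Adding a ∘ b to either side gives a ∘ u ∘ b, bracketed in two ways; centrality moves the term in
    [u] past the other summand. *)
Let cen_lam_rho a b u : cen_lam a (cen_rho b u) = cen_rho b (cen_lam a u).
Proof.
have lamC : a + lam a (rho b (sval u)) = lam a (rho b (sval u)) + a.
  exact: (center_typeP (cen_lam a (cen_rho b u))).
have rhoC : rho b a + rho b (lam a (sval u)) = rho b (lam a (sval u)) + rho b a.
  exact: (center_typeP (cen_rho b (cen_lam a u))).
apply: cen_inj; apply: (@brace_addIr _ (a ∘ b)); transitivity (a ∘ sval u ∘ b).
  rewrite -[RHS]mulgA [(sval u * b)%g]circ_rho [RHS]circ_lam lamD brace_addA.
  by rewrite lamC -[RHS]brace_addA -[in RHS]circ_lam.
rewrite [(a * sval u)%g]circ_lam [LHS]circ_rho (rhoD two_sidedA).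
by rewrite rhoC -[LHS]brace_addA -[in LHS]circ_rho.
Qed.

Definition cen_starl a u : center_type := (cen_lam a u - u)%R.
Definition cen_starr a u : center_type := (cen_rho a u - u)%R.

Lemma sval_starl a u : sval (cen_starl a u) = star a (sval u).
Proof. by rewrite star_lam. Qed.

Lemma sval_starr a u : sval (cen_starr a u) = star (sval u) a.
Proof. by rewrite star_rho; apply: (center_typeP (- u)%R). Qed.

Let cen_starlD a u v : cen_starl a (u + v)%R = (cen_starl a u + cen_starl a v)%R.
Proof. by rewrite /cen_starl cen_lamD opprD addrACA. Qed.

Let cen_starrD a u v : cen_starr a (u + v)%R = (cen_starr a u + cen_starr a v)%R.
Proof. by rewrite /cen_starr cen_rhoD opprD addrACA. Qed.

Let cen_starlB a u v : cen_starl a (u - v)%R = (cen_starl a u - cen_starl a v)%R.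
Proof. by apply/eqP; rewrite eq_sym subr_eq -cen_starlD subrK. Qed.

Let cen_starrB a u v : cen_starr a (u - v)%R = (cen_starr a u - cen_starr a v)%R.
Proof. by apply/eqP; rewrite eq_sym subr_eq -cen_starrD subrK. Qed.

Let cen_starl_0 a : cen_starl a 0%R = 0%R.
Proof. by apply: (addrI (cen_starl a 0%R)); rewrite -cen_starlD !addr0. Qed.

Let cen_starr_0 a : cen_starr a 0%R = 0%R.
Proof. by apply: (addrI (cen_starr a 0%R)); rewrite -cen_starrD !addr0. Qed.

Let cen_starlMn a u n : (cen_starl a (u *+ n) = cen_starl a u *+ n)%R.
Proof.
by elim: n => [|n IHn]; rewrite ?mulr0n ?cen_starl_0 // !mulrS cen_starlD IHn.
Qed.

Let cen_starrMn a u n : (cen_starr a (u *+ n) = cen_starr a u *+ n)%R.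
Proof.
by elim: n => [|n IHn]; rewrite ?mulr0n ?cen_starr_0 // !mulrS cen_starrD IHn.
Qed.

(** Written with [rho], which is additive by two-sidedness, (a + b) * u is -b + (a * u) + rho_u(b),
    and a * u is central. *)
Let cen_starl_addl a b u : cen_starl (a + b) u = (cen_starl a u + cen_starl b u)%R.
Proof.
apply: cen_inj; rewrite sval_starl star_rho (rhoD two_sidedA) brace_oppD.
rewrite [(_ + _)%R]addrC -brace_addA (brace_addA (- a)) -star_rho -sval_starl.
by rewrite -(center_typeP (cen_starl a u)) brace_addA -star_rho -sval_starl.
Qed.

Let cen_starr_addl a b u : cen_starr (a + b) u = (cen_starr a u + cen_starr b u)%R.
Proof.
apply: cen_inj; rewrite sval_starr star_lam lamD brace_oppD.
rewrite -brace_addA (brace_addA _ (- b)) -star_lam -sval_starr.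
by rewrite -(center_typeP (cen_starr b u)) brace_addA -star_lam -sval_starr.
Qed.

Let star_decomp a b : a ∘ b = a + star a b + b.
Proof. by rewrite star_rho brace_addNKl -circ_rho. Qed.

(** Expand [lam (a ∘ b)] = [lam a] composed with [lam b], using lam = 1 + star and a ∘ b = a + a * b
    + b, and cancel. *)
Let cen_starl_comp a b u : cen_starl a (cen_starl b u) = cen_starl (star a b) u.
Proof.
have lamE c v : cen_lam c v = (cen_starl c v + v)%R by rewrite subrK.
have := cen_lamM a b u; rewrite lamE (lamE b) cen_lamD !lamE addrA => /addIr.
rewrite star_decomp !cen_starl_addl [RHS]addrAC => /addIr.
by rewrite [LHS]addrC => /addIr ->.
Qed.

Let cen_starr_comp a b u : cen_starr b (cen_starr a u) = cen_starr (star a b) u.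
Proof.
have rhoE c v : cen_rho c v = (cen_starr c v + v)%R by rewrite subrK.
have := cen_rhoM a b u; rewrite rhoE (rhoE a) cen_rhoD !rhoE addrA => /addIr.
by rewrite star_decomp !cen_starr_addl => /addIr; rewrite [LHS]addrC => /addIr ->.
Qed.

Let cen_starlr a b u : cen_starl a (cen_starr b u) = cen_starr b (cen_starl a u).
Proof.
rewrite [in LHS]/cen_starr cen_starlB [in RHS]/cen_starl cen_starrB.
rewrite /cen_starl /cen_starr.
by rewrite cen_lam_rho !opprB addrACA [RHS]addrACA [(- _ - _)%R]addrC.
Qed.

Let cen_starl0 u : cen_starl 0 u = 0%R.
Proof.
by apply: (addrI (cen_starl 0 u)); rewrite -cen_starl_addl brace_add0l addr0.
Qed.

Let cen_starr0 u : cen_starr 0 u = 0%R.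
Proof.
by apply: (addrI (cen_starr 0 u)); rewrite -cen_starr_addl brace_add0l addr0.
Qed.

Lemma radical_action_starl : radical_action cen_starl.
Proof.
split; first exact: cen_starlD.
- by exists 0 => u; rewrite cen_starl0.
- move=> a b; exists (a - b) => u; apply/eqP.
  by rewrite eq_sym subr_eq -cen_starl_addl brace_subK.
- by move=> a b; exists (star a b) => u; rewrite cen_starl_comp.
(* Since 1 + [cen_starl a] is [cen_lam a], the circle inverse of [a] provides the quasi-inverse. *)
- move=> a; exists a^-1%g => u; rewrite addrC subrK {1}/cen_starl opprB.
  by congr (_ - _)%R; apply/cen_inj/lamK.
Qed.

Lemma radical_action_starr : radical_action cen_starr.
Proof.
split; first exact: cen_starrD.
- by exists 0 => u; rewrite cen_starr0.
- move=> a b; exists (a - b) => u; apply/eqP.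
  by rewrite eq_sym subr_eq -cen_starr_addl brace_subK.
- by move=> a b; exists (star b a) => u; rewrite cen_starr_comp.
- move=> a; exists a^-1%g => u; rewrite addrC subrK {1}/cen_starr opprB.
  by congr (_ - _)%R; apply/cen_inj/(rhoK two_sidedA).
Qed.

Definition annihilator : set A :=
  [set z | add_center z /\ forall a, star a z = 0 /\ star z a = 0].

Definition bimodule (W : set center_type) : Prop :=
  [/\ add_subgroup W, forall a u, W u -> W (cen_starl a u) &
      forall a u, W u -> W (cen_starr a u)].

(* The left action kills a nonzero submodule, which is a right submodule      *)
(* because the two actions commute, so the right action kills part of it.     *)
Lemma bimodule_annihilator (P : set center_type -> Prop) W :
    no_ascending P -> (forall H, add_subgroup H -> H `<=` W -> P H) ->
    bimodule W -> (exists2 u, W u & u != 0%R) ->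
  exists2 z : A, annihilator z & z <> 0.
Proof.
move=> accP subP [gW Wl Wr] nzW.
have mW : submodule cen_starl W by [].
have [u [Wu nz_u ul]] :=
  radical_action_killed radical_action_starl accP subP mW nzW.
pose V : set center_type := [set v | W v /\ forall a, cen_starl a v = 0%R].
have [|||v [[Wv vl] nz_v vr]] :=
  radical_action_killed (W := V) radical_action_starr accP.
- by move=> H gH sHV; apply: subP => // v /sHV[].
- split; first split.
  + by split; [case: gW | ].
  + move=> v w [Wv v0] [Ww w0]; split; first exact: gW.2.
    by move=> a; rewrite cen_starlB v0 w0 subr0.
  + move=> a v [Wv v0]; split=> [|b]; first exact: Wr.
    by rewrite cen_starlr v0 cen_starr_0.
- by exists u.
exists (sval v).
  split; first exact: center_typeP.
  by move=> a; rewrite -sval_starl -sval_starr vl vr.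
by move=> v0; move/eqP: nz_v; apply; apply: cen_inj.
Qed.

Definition cen_mul u v : center_type := cen_starl (sval u) v.

Let cen_mulE u v : cen_mul u v = cen_starr (sval v) u.
Proof. by apply: cen_inj; rewrite sval_starl sval_starr. Qed.

Let cen_mulA : associative cen_mul.
Proof. by move=> u v w; rewrite /cen_mul cen_starl_comp sval_starl. Qed.

Let cen_mulDl : left_distributive cen_mul +%R.
Proof. by move=> u v w; apply: cen_starl_addl. Qed.

Let cen_mulDr : right_distributive cen_mul +%R.
Proof. by move=> u v w; apply: cen_starlD. Qed.

Let cen_mul0 u : cen_mul u 0%R = 0%R.
Proof. exact: cen_starl_0. Qed.

Let cen_0mul u : cen_mul 0%R u = 0%R.
Proof. exact: cen_starl0. Qed.

Let cen_mulBl u v w : cen_mul (u - v)%R w = (cen_mul u w - cen_mul v w)%R.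
Proof. by apply/eqP; rewrite eq_sym subr_eq -cen_mulDl subrK. Qed.

Let cen_mulBr u v w : cen_mul u (v - w)%R = (cen_mul u v - cen_mul u w)%R.
Proof. exact: cen_starlB. Qed.

Let cen_mul_starl a u v : cen_mul (cen_starl a u) v = cen_starl a (cen_mul u v).
Proof. by rewrite /cen_mul cen_starl_comp sval_starl. Qed.

Let cen_mul_starlr a u v : cen_mul (cen_starr a u) v = cen_mul u (cen_starl a v).
Proof. by rewrite /cen_mul cen_starl_comp sval_starr. Qed.

Let cen_mul_starr a u v : cen_mul u (cen_starr a v) = cen_starr a (cen_mul u v).
Proof. exact: cen_starlr. Qed.

(** On the centre, the circle operation is the adjoint operation of the ring with product
    [cen_mul]. *)
Let circ_cen_mul u v : sval u ∘ sval v = sval (u + v + cen_mul u v)%R.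
Proof.
have <- : (u + cen_mul u v + v)%R = (u + v + cen_mul u v)%R by rewrite addrAC.
by rewrite star_decomp -sval_starl.
Qed.

Let quasi_regular_cen u :
  exists2 v, (u + v + cen_mul u v)%R = 0%R & (v + u + cen_mul v u)%R = 0%R.
Proof.
have [_ _ cV] := ideal_circ_subgroup ideal_add_center.
exists (to_center (cV _ (center_typeP u))); apply: cen_inj.
  by rewrite -circ_cen_mul [LHS]mulgV -brace_zero1.
by rewrite -circ_cen_mul [LHS]mulVg -brace_zero1.
Qed.

Let circ_max_quasi : max_on_subgroups (circ_group A) ->
  no_ascending (quasi_subgroup cen_mul).
Proof.
move=> /(no_ascending_image cen_inj) maxA [H HP]; apply: maxA; exists H => n.
have [[H0 HM HV] lt_H] := HP n; split=> //; split.
- by exists 0%R => //; apply: brace_zero1.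
- move=> _ _ [u Hu <-] [v Hv <-]; exists (u + v + cen_mul u v)%R; first exact: HM.
  exact/esym/circ_cen_mul.
- move=> _ [u Hu <-]; have [v uv vu] := quasi_regular_cen u.
  exists v; first exact: HV uv vu.
  apply: (@mulgI _ (sval u)); rewrite mulgV.
  by rewrite -brace_zero1 -[0]/(sval (0%R : center_type)) -uv; apply: circ_cen_mul.
Qed.

(* Once a nonzero [a] with [a W a = 0] is known, a null bimodule is either an *)
(* annihilator of [W] or the span of [W a W].                                 *)
Let null_bimodule W : bimodule W -> (exists a : center_type, [/\ W a, a != 0%R &
    forall w, W w -> cen_mul (cen_mul a w) a = 0%R]) ->
  exists I, [/\ bimodule I, exists2 u, I u & u != 0%R &
    forall u v, I u -> I v -> cen_mul u v = 0%R].
Proof.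
move=> [gW Wl Wr] [a [Wa nz_a aWa]].
pose Nr : set center_type :=
  [set x | W x /\ forall w, W w -> cen_mul x w = 0%R].
have [nzNr|noNr] := pselect (exists2 x, Nr x & x != 0%R).
  exists Nr; split=> //.
    split; first split.
    - by split; [case: gW | move=> w _; apply: cen_0mul].
    - move=> x y [Wx x0] [Wy y0]; split; first exact: gW.2.
      by move=> w Ww; rewrite cen_mulBl x0 ?y0 ?subr0.
    - move=> b x [Wx x0]; split=> [|w Ww]; first exact: Wl.
      by rewrite cen_mul_starl x0.
    - move=> b x [Wx x0]; split=> [|w Ww]; first exact: Wr.
      by rewrite cen_mul_starlr x0 //; apply: Wl.
  by move=> u v [Wu u0] [Wv _]; apply: u0.
pose Nl : set center_type :=
  [set x | W x /\ forall w, W w -> cen_mul w x = 0%R].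
have [nzNl|noNl] := pselect (exists2 x, Nl x & x != 0%R).
  exists Nl; split=> //.
    split; first split.
    - by split; [case: gW | move=> w _; apply: cen_mul0].
    - move=> x y [Wx x0] [Wy y0]; split; first exact: gW.2.
      by move=> w Ww; rewrite cen_mulBr x0 ?y0 ?subr0.
    - move=> b x [Wx x0]; split=> [|w Ww]; first exact: Wl.
      by rewrite -cen_mul_starlr x0 //; apply: Wr.
    - move=> b x [Wx x0]; split=> [|w Ww]; first exact: Wr.
      by rewrite cen_mul_starr x0.
  by move=> u v [Wu _] [Wv v0]; apply: v0.
pose X : set center_type := [set z | exists x y : center_type,
  [/\ W x, W y & z = cen_mul (cen_mul x a) y]].
pose I := smallest (@add_subgroup center_type) X.
have gI : add_subgroup I := add_subgroup_smallest X.
have XI (z : center_type) : X z -> I z by apply: sub_gen_smallest.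
have stable (f : center_type -> center_type) :
    f 0%R = 0%R -> (forall v w, f (v - w) = f v - f w)%R ->
    (forall z : center_type, X z -> X (f z)) ->
    forall z : center_type, I z -> I (f z).
  move=> f0 fB fX; apply: smallest_sub => [|z /fX]; last exact: XI.
  split; first by rewrite /= f0; case: gI.
  by move=> v w Iv Iw; rewrite /= fB; apply: gI.2.
have killed (f : center_type -> center_type) :
    f 0%R = 0%R -> (forall v w, f (v - w) = f v - f w)%R ->
    (forall z : center_type, X z -> f z = 0%R) ->
    forall z : center_type, I z -> f z = 0%R.
  move=> f0 fB fX; apply: smallest_sub => [|z /fX//].
  by split=> // v w fv fw; rewrite /= fB fv fw subr0.
have WM u v : W v -> W (cen_mul u v) /\ W (cen_mul v u).
  by move=> Wv; split; [apply: Wl | rewrite cen_mulE; apply: Wr].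
exists I; split.
- split=> // b u.
    apply: stable => // _ [x [y [Wx Wy ->]]].
    by exists (cen_starl b x), y; rewrite !cen_mul_starl; split=> //; apply: Wl.
  apply: stable => // _ [x [y [Wx Wy ->]]].
  by exists x, (cen_starr b y); rewrite cen_mul_starr; split=> //; apply: Wr.
(* As [Nr] and [Nl] are zero, some a y is nonzero, and then some x a y is. *)
- have [y Wy nz_ay] : exists2 y : center_type, W y & cen_mul a y != 0%R.
    apply: contrapT => noy; apply: noNr; exists a => //; split=> // w Ww.
    by apply: contrapT => /eqP nz; apply: noy; exists w.
  have [x Wx nz_xay] : exists2 x : center_type, W x & cen_mul x (cen_mul a y) != 0%R.
    apply: contrapT => nox; apply: noNl; exists (cen_mul a y) => //.
    split=> [|w Ww]; first by case: (WM a y Wy).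
    by apply: contrapT => /eqP nz; apply: nox; exists w.
  by exists (cen_mul x (cen_mul a y)) => //; apply: XI; exists x, y; rewrite cen_mulA.
- move=> u v Iu Iv; apply: (killed (cen_mul^~ v)) Iu => //=.
  move=> _ [x [y [Wx Wy ->]]]; apply: (killed (cen_mul _)) Iv => //.
  move=> _ [x' [y' [Wx' Wy' ->]]].
  (* The product contains the factor a (y x') a, which vanishes. *)
  have -> : cen_mul (cen_mul (cen_mul x a) y) (cen_mul (cen_mul x' a) y') =
      cen_mul (cen_mul x (cen_mul (cen_mul a (cen_mul y x')) a)) y'.
    by rewrite !cen_mulA.
  by rewrite aWa ?cen_mul0 ?cen_0mul //; case: (WM y x' Wx').
Qed.

Lemma annihilator_nontrivial :
    max_on_subgroups (add_group A) \/ max_on_subgroups (circ_group A) ->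
    (exists2 z : A, add_center z & z <> 0) ->
  exists2 z : A, annihilator z & z <> 0.
Proof.
move=> maxA [z cz nz_z].
have nzT : exists2 u : center_type, setT u & u != 0%R.
  by exists (to_center cz) => //; apply/eqP => /(congr1 sval).
have gT : add_subgroup [set: center_type] by [].
case: maxA => [maxA|maxA].
  apply: (bimodule_annihilator (no_ascending_image cen_inj maxA)) nzT => //.
  move=> H gH _; split.
  - by exists 0%R => //; case: gH.
  - move=> _ _ [u Hu <-] [v Hv <-]; exists (u + v)%R => //.
    exact: add_subgroupD.
  - by move=> _ [u Hu <-]; exists (- u)%R => //; apply: add_subgroupN.
(* [W] is the [p]-torsion of the centre for some prime [p] if one has any, and the whole centre
   otherwise. *)
have [W [mW nzW torsW]] : exists W : set center_type,
    [/\ bimodule W, exists2 u, W u & u != 0%R &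
      (exists2 p, prime p & forall x, W x -> (x *+ p = 0)%R) \/
      (forall (x : center_type) n, (0 < n)%N -> (x *+ n = 0)%R -> x = 0%R)].
  have [[p [x [p_pr nz_x px0]]]|notor] := pselect (exists p (x : center_type),
      [/\ prime p, x != 0%R & (x *+ p)%R = 0%R]).
    exists [set u : center_type | (u *+ p)%R = 0%R]; split; last by left; exists p.
      split=> [|a u /= u0|a u /= u0]; last 2 first.
      - by rewrite -cen_starlMn u0 cen_starl_0.
      - by rewrite -cen_starrMn u0 cen_starr_0.
      split=> [|u v /= u0 v0]; first exact: mul0rn.
      by rewrite mulrnBl u0 v0 subr0.
    by exists x.
  exists setT; split=> //; right=> x n n_gt0.
  apply: (torsion_free_primes gT) => // p y p_pr _ py0.
  apply: contrapT => /eqP nz_y; apply: notor.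
  by exists p, y.
have [gW Wl Wr] := mW.
have WM u v : W v -> W (cen_mul u v) /\ W (cen_mul v u).
  by move=> Wv; split; [apply: Wl | rewrite cen_mulE; apply: Wr].
have /(null_bimodule mW)[I [mI nzI I0]] :=
  quasi_regular_sandwich cen_mulA cen_mulDl cen_mulDr quasi_regular_cen
    (circ_max_quasi maxA) gW WM nzW torsW.
(* The two operations agree on [I]. *)
apply: (bimodule_annihilator (no_ascending_image cen_inj maxA)) mI nzI.
move=> H gH sHI; split.
- by exists 0%R; [case: gH | apply: brace_zero1].
- move=> _ _ [u Hu <-] [v Hv <-]; exists (u + v)%R; first exact: add_subgroupD.
  rewrite -[LHS]/(sval (u + v)%R) -[(u + v)%R]addr0 -(I0 u v); try exact: sHI.
  exact/esym/circ_cen_mul.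
- move=> _ [u Hu <-]; have HNu := add_subgroupN gH Hu; exists (- u)%R => //.
  apply: (@mulgI _ (sval u)); rewrite mulgV -brace_zero1.
  rewrite -[0]/(sval (0%R : center_type)) -(subrr u) -[(u - u)%R]addr0.
  by rewrite -(I0 u (- u)%R); [apply: circ_cen_mul | apply: sHI | apply: sHI].
Qed.

End Center.

(** * The upper central series of a skew brace *)

Section NilpotentGroups.
Local Open Scope group_scope.

Lemma subgroup_generated (G : groupType) (X : set G) : subgroup (generated X).
Proof.
split=> [H [[]]//|x y Xx Xy H sH|x Xx H sH]; have [[_ HM HV] _] := sH.
  by apply: HM; [apply: Xx | apply: Xy].
by apply: HV; apply: Xx.
Qed.

Lemma lower_central1 (G : groupType) n : @lower_central G n 1.
Proof. by case: n => //= n H [[]]. Qed.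

(** The last nontrivial term of the lower central series is central. *)
Lemma nilpotent_center (G : groupType) : nilpotent_group G ->
  (exists x : G, x <> 1) -> exists2 z : G, z <> 1 & forall a, a * z = z * a.
Proof.
move=> [n]; elim: n => [|n IHn] /= lcn nt.
  by have [x] := nt; have : [set: G] x by []; rewrite lcn => /= ->.
have [[z lz nz_z]|triv] := pselect (exists2 z : G, lower_central n z & z <> 1).
  exists z => // a; suff: [set 1] [~ z, a].
    move=> /(congr1 (fun x => a * (z * x))).
    by rewrite /commg /conjg !mulVKg mulg1.
  by rewrite -lcn; apply: sub_gen_smallest; exists z => //; exists a.
apply: IHn => //; apply/seteqP; split=> [z lz|_ ->].
  by apply: contrapT => nz_z; apply: triv; exists z.
exact: lower_central1.
Qed.

Lemma max_on_subgroups_surj (G G' : groupType) (f : G -> G') :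
    {morph f : x y / x * y} -> (forall y, exists x, f x = y) ->
  max_on_subgroups G -> max_on_subgroups G'.
Proof.
move=> fM f_surj maxG [H HP]; apply: maxG; exists (fun n => f @^-1` H n) => n.
have [[H1 HM HV] [sH nsH]] := HP n.
have f1 : f 1 = 1 by apply: (mulgI (f 1)); rewrite -fM !mulg1.
have fV x : f x^-1 = (f x)^-1 by apply: (mulgI (f x)); rewrite -fM !mulgV.
split; first split; rewrite /preimage /=.
- by rewrite f1.
- by move=> x y Hx Hy; rewrite fM; apply: HM.
- by move=> x Hx; rewrite fV; apply: HV.
split=> [x /sH//|sH']; apply: nsH => y; have [x <-] := f_surj y; exact: sH'.
Qed.

Lemma nilpotent_group_surj (G G' : groupType) (f : G -> G') :
    {morph f : x y / x * y} -> (forall y, exists x, f x = y) ->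
  nilpotent_group G -> nilpotent_group G'.
Proof.
move=> fM f_surj [n lcn]; exists n.
have f1 : f 1 = 1 by apply: (mulgI (f 1)); rewrite -fM !mulg1.
have fV x : f x^-1 = (f x)^-1 by apply: (mulgI (f x)); rewrite -fM !mulgV.
have sub k : lower_central k `<=` f @` lower_central k.
  elim: k => [|k IHk] /= y; first by have [x] := f_surj y; exists x.
  have [g1 gM gV] := subgroup_generated
    [set [~ x, y] | x in lower_central k & y in [set: G]].
  apply: smallest_sub => [|_ [y1 /IHk[x1 lx1 <-]] [y2 _ <-]].
    split; first by exists 1.
    - by move=> _ _ [u gu <-] [v gv <-]; exists (u * v); [apply: gM | apply: fM].
    - by move=> _ [u gu <-]; exists u^-1; [apply: gV | apply: fV].
  have [x2 <-] := f_surj y2; exists [~ x1, x2]; last by rewrite !(fM, fV).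
  by apply: sub_gen_smallest; exists x1 => //; exists x2.
apply/seteqP; split=> [y /sub[x]|_ ->]; first by rewrite lcn => -> <-.
exact: lower_central1.
Qed.

End NilpotentGroups.

Section Annihilator.
Variable A : skewBraceType.
Local Open Scope brace_scope.
Implicit Types a z : A.

Lemma star_eq0l a z : star a z = 0 <-> lam a z = z.
Proof.
rewrite star_lam; split=> [lz|->]; last exact: brace_addNr.
by rewrite -(brace_subK (lam a z) z) lz brace_add0l.
Qed.

Lemma star_eq0r a z : star z a = 0 <-> rho a z = z.
Proof.
rewrite star_rho; split=> [rz|->]; last exact: brace_addNl.
by rewrite -(brace_addNKl z (rho a z)) rz brace_add0r.
Qed.

Lemma ideal_annihilator : two_sided A -> ideal (@annihilator A).
Proof.
move=> two_sidedA; have [c0 cB cJ _ _] := ideal_add_center two_sidedA.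
split.
- split=> // a; rewrite star_eq0l star_eq0r lam0.
  by rewrite (rho0 a).
- move=> x y [cx x0] [cy y0]; split; first exact: cB.
  move=> a; have [/star_eq0l lx /star_eq0r rx] := x0 a.
  have [/star_eq0l ly /star_eq0r ry] := y0 a.
  rewrite star_eq0l star_eq0r lamD lamN lx ly.
  by rewrite (rhoD two_sidedA) (rhoN two_sidedA) rx ry.
- by move=> a x [cx x0]; rewrite cx brace_addK.
- by move=> a x [cx x0]; have [/star_eq0l -> _] := x0 a.
- by move=> a x [cx x0]; have [_ /star_eq0r ->] := x0 a.
Qed.

End Annihilator.

Section UpperSeries.
Variable A : skewBraceType.
Hypothesis two_sidedA : two_sided A.
Local Open Scope brace_scope.
Implicit Types (a b c x y z : A) (K : set A).

(** The preimage of the annihilator of the quotient by [K], phrased inside [A] so that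
    [upper_series] can be defined before its terms are known to be ideals. *)
Definition annihilator_mod K : set A :=
  [set z | forall a, [/\ K ((a + z) - (z + a)), K (star a z) & K (star z a)]].

Fixpoint upper_series n : set A :=
  if n is m.+1 then annihilator_mod (upper_series m) else [set 0].

Section Quotient.
Variables (K : set A) (idK : ideal K).
Local Notation pi := (quotient_map two_sidedA idK).

Lemma quotient_mapK x : pi x = 0 <-> K x.
Proof.
by have := quotient_mapP two_sidedA idK x 0; rewrite brace_opp0 brace_add0r.
Qed.

Lemma quotient_mapN x : pi (- x) = - pi x.
Proof.
apply: (@brace_addI _ (pi x)); rewrite -quotient_mapD !brace_addNr.
exact: erefl.
Qed.

Let pi_star x y : pi (star x y) = star (pi x) (pi y).
Proof. by rewrite /star !quotient_mapD quotient_mapM !quotient_mapN. Qed.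

Lemma two_sided_quotient : two_sided (brace_quotient two_sidedA idK).
Proof.
move=> u v w; have [a <-] := quotient_map_surj u.
have [b <-] := quotient_map_surj v; have [c <-] := quotient_map_surj w.
by rewrite -quotient_mapD -!quotient_mapM two_sidedA !quotient_mapD quotient_mapN.
Qed.

Lemma annihilator_mod_quotient z : annihilator_mod K z <-> annihilator (pi z).
Proof.
split=> [Kz|[cz z0] a].
  split=> u; have [a <-] := quotient_map_surj u; have [K1 K2 K3] := Kz a.
    by rewrite -!quotient_mapD; apply/quotient_mapP.
  by rewrite -!pi_star !quotient_mapK.
have [zl zr] := z0 (pi a); split; last 2 first.
- by apply/quotient_mapK; rewrite pi_star.
- by apply/quotient_mapK; rewrite pi_star.
by apply/(quotient_mapP two_sidedA idK); rewrite !quotient_mapD.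
Qed.

Lemma ideal_preimage (I : set (brace_quotient two_sidedA idK)) : ideal I ->
  ideal (pi @^-1` I).
Proof.
move=> [I0 IB IJ Il Ir]; split=> //=.
- by move=> x y Ix Iy; rewrite quotient_mapD quotient_mapN; apply: IB.
- by move=> a x Ix; rewrite !quotient_mapD quotient_mapN; apply: IJ.
- by move=> a x Ix; rewrite quotient_mapD quotient_mapN quotient_mapM; apply: Il.
- by move=> a x Ix; rewrite quotient_mapD quotient_mapN quotient_mapM; apply: Ir.
Qed.

End Quotient.

Lemma ideal_annihilator_mod K : ideal K -> ideal (annihilator_mod K).
Proof.
move=> idK.
have -> : annihilator_mod K = quotient_map two_sidedA idK @^-1` @annihilator _.
  by apply/seteqP; split=> z; rewrite (annihilator_mod_quotient idK).
exact/ideal_preimage/ideal_annihilator/(@two_sided_quotient _ idK).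
Qed.

Lemma sub_annihilator_mod K : ideal K -> K `<=` annihilator_mod K.
Proof.
move=> idK z Kz; rewrite (annihilator_mod_quotient idK).
have /quotient_mapK -> := Kz.
by have [] := ideal_annihilator (@two_sided_quotient _ idK).
Qed.

Lemma ideal_upper_series n : ideal (upper_series n).
Proof.
elim: n => [|n IHn] /=; last exact: ideal_annihilator_mod.
split=> //= [x y -> ->|a x ->|a x ->|a x ->].
- by rewrite brace_opp0 brace_add0r.
- by rewrite brace_add0r brace_addNr.
- exact: lam0.
- exact: rho0.
Qed.

Lemma upper_series_full :
    max_on_subgroups (add_group A) \/ max_on_subgroups (circ_group A) ->
    nilpotent_group (add_group A) ->
  exists n, upper_series n = [set: A].
Proof.
move=> maxA nilA.
have [n stab] : exists n, upper_series n.+1 `<=` upper_series n.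
  apply: contrapT => nstab.
  have lt_upper n : upper_series n `<` upper_series n.+1.
    split; first exact: sub_annihilator_mod (ideal_upper_series n).
    by move=> stab; apply: nstab; exists n.
  (* Ideals are subgroups of both groups, so either maximum condition applies. *)
  case: maxA => maxA; apply: maxA; exists upper_series => n; split=> //.
    exact: ideal_subgroup (ideal_upper_series n).
  exact: ideal_circ_subgroup (ideal_upper_series n).
exists n; apply/seteqP; split=> // x _; apply: contrapT => nKx.
have idK := ideal_upper_series n.
pose B : skewBraceType := brace_quotient two_sidedA idK.
pose pi : A -> B := quotient_map two_sidedA idK.
have surj_pi : forall u : B, exists a, pi a = u by apply: quotient_map_surj.
have maxB : max_on_subgroups (add_group B) \/ max_on_subgroups (circ_group B).
  case: maxA => maxA; [left|right].
    apply: (@max_on_subgroups_surj (add_group A) (add_group B) pi) => //.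
    exact: (quotient_mapD two_sidedA idK).
  apply: (@max_on_subgroups_surj (circ_group A) (circ_group B) pi) => //.
  exact: (quotient_mapM two_sidedA idK).
have nilB : nilpotent_group (add_group B).
  apply: (@nilpotent_group_surj (add_group A) (add_group B) pi) => //.
  exact: (quotient_mapD two_sidedA idK).
have [|z nz_z cz] := nilpotent_center nilB.
  by exists (pi x) => /(quotient_mapK idK).
have [|u] := annihilator_nontrivial (@two_sided_quotient _ idK) maxB.
  by exists z.
have [y <-] := surj_pi u; move=> /(annihilator_mod_quotient idK) /stab Ky.
by case; apply/quotient_mapK.
Qed.

(** When two indices sum to at least 2^(j+1), one of them is at least 2^j; a single factor in a term
    of the upper series, on either side, puts the star product one term lower. *)
Lemma strong_power_sub_upper m j k : upper_series m = [set: A] -> (j <= m)%N ->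
  (2 ^ j <= k)%N -> @strong_power A k `<=` upper_series (m - j).
Proof.
move=> fullA; elim: j k => [|j IHj] k lt_jm; first by rewrite subn0 fullA.
case: k => [|k]; first by rewrite leqNgt expn_gt0.
move=> le_k; have k_gt0 : (0 < k)%N.
  by rewrite -ltnS (leq_trans _ le_k) // expnS leq_pmulr ?expn_gt0.
have idU := ideal_upper_series (m - j.+1).
have mj : (m - j = (m - j.+1).+1)%N by rewrite -subSn.
have subU n : (2 ^ j <= n)%N ->
    @strong_power A n `<=` annihilator_mod (upper_series (m - j.+1)).
  by move=> le_n; have := IHj n (ltnW lt_jm) le_n; rewrite mj.
rewrite strong_powerS //; apply: smallest_sub; first exact: ideal_subgroup idU.
move=> z [i /= /andP[i_gt0 le_ik]]; apply: smallest_sub.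
  exact: ideal_subgroup idU.
move=> _ [x Sx [y Sy <-]].
have [le_i|lt_i] := leqP (2 ^ j) i.
  by have [] := subU i le_i x Sx y.
have [|_ + _] := subU (k.+1 - i)%N _ y Sy x; last by [].
move: le_k; rewrite expnS mul2n -addnn => le_k.
by move: le_k lt_i; move: (2 ^ j)%N => p; lia.
Qed.

Lemma lower_central_sub_upper m j : upper_series m = [set: A] -> (j <= m)%N ->
  @lower_central (circ_group A) j `<=` upper_series (m - j).
Proof.
move=> fullA; elim: j => [|j IHj] lt_jm /=; first by rewrite subn0 fullA.
have idU := ideal_upper_series (m - j.+1).
apply: smallest_sub; first exact: ideal_circ_subgroup idU.
move=> _ [x /(IHj (ltnW lt_jm)) + [y _ <-]].
rewrite (_ : m - j = (m - j.+1).+1)%N; last by rewrite -subSn.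
move=> /(annihilator_mod_quotient idU)[cx /(_ (quotient_map _ idU y))].
rewrite star_eq0l => -[lx /star_eq0l lx'].
(* Modulo the lower term, x ∘ y = x + y = y + x = y ∘ x. *)
have Uc : upper_series (m - j.+1) (- (y ∘ x) + x ∘ y).
  apply/(quotient_mapK idU); rewrite quotient_mapD quotient_mapN !quotient_mapM.
  by rewrite !circ_lam lx lx' cx brace_addNl.
have -> : [~ (x : circ_group A), y]%g = lam (y ∘ x)^-1%g (- (y ∘ x) + x ∘ y).
  rewrite lamD lamN /lam mulVg -brace_zero1 brace_add0r brace_oppK brace_addNKl.
  by rewrite /commg /conjg invgM !mulgA.
exact: ideal_lam.
Qed.

End UpperSeries.

Theorem theorem4p27 (A : skewBraceType)
    (two_sidedA : two_sided A)
    (maxA : max_on_subgroups (add_group A) \/ max_on_subgroups (circ_group A))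
    (nilA : nilpotent_group (add_group A)) :
  nilpotent_group (circ_group A) /\ strongly_nilpotent A.
Proof.
have [m fullA] := upper_series_full two_sidedA maxA nilA; split.
  exists m; apply/seteqP; split=> [x|_ ->]; last exact: lower_central1.
  move/(lower_central_sub_upper two_sidedA fullA (leqnn m)).
  by rewrite subnn /= brace_zero1.
exists (2 ^ m)%N; split; first by rewrite expn_gt0.
apply/seteqP; split=> [x|_ ->].
  move/(strong_power_sub_upper two_sidedA fullA (leqnn m) (leqnn _)).
  by rewrite subnn.
rewrite /strong_power; case: (2 ^ m)%N => //= -[|k] //=.
by rewrite ltnn => H [[]].
Qed.
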